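(* The growth rate of the class of permutations avoiding $1324$ satisfies $\mathrm{gr}(\mathrm{Av}(1324)) > 9.81$.
   Context: A permutation $\sigma=\sigma_1\cdots\sigma_n$ of $\{1,\dots,n\}$ avoids a permutation $\pi$ of $\{1,\dots,k\}$ if no subsequence of $\sigma$ has the same relative order as $\pi$. $\mathrm{Av}(1324)$ is the set of permutations avoiding $1324$, and $S_n(1324)$ is the number of such permutations of length $n$. The growth rate is $\mathrm{gr}(\mathrm{Av}(1324))=\lim_{n\to\infty} S_n(1324)^{1/n}$; this limit exists and is finite. *)

(* Defs.v *)
From mathcomp Require Import all_boot all_fingroup.

Set Implicit Arguments. Unset Strict Implicit. Unset Printing Implicit Defensive.

(* A permutation s of {0,...,n-1} (i.e. of {1..n} shifted by one) contains the
   pattern p (a sequence of distinct naturals, read only up to relative order)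
   if there are positions f 0 < f 1 < ... < f (k-1) (k = size p) such that
   s (f a) < s (f b)  iff  p_a < p_b, for all a b. *)
Definition contains_pattern (n : nat) (s : 'S_n) (p : seq nat) : bool :=
  [exists f : {ffun 'I_(size p) -> 'I_n},
     [forall a : 'I_(size p), forall b : 'I_(size p),
        ((a < b) ==> (f a < f b)) &&
        ((s (f a) < s (f b)) == (nth 0 p a < nth 0 p b))]].

Definition avoids (n : nat) (s : 'S_n) (p : seq nat) : bool :=
  ~~ contains_pattern s p.

Definition S1324 (n : nat) : nat :=
  #|[set s : 'S_n | avoids s [:: 1; 3; 2; 4]]|.

(* Main.v *)
(* A domino is a 1324-avoider cut into b entries forming a 132-avoider
   and t entries forming a 213-avoider; there are (27/4)^(n + o(n)) of them with
   n = b + t entries.  In a staircase of cells descending to the right, every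
   occurrence of 1324 lies in two consecutive cells, so dominoes can be chained
   by putting a decreasing cell between two consecutive ones.  A decreasing cell
   of r entries interleaves freely with its two neighbours of b entries, which
   gives binomial(b + r, r)^2 choices; r = b/2 makes this (27/4)^(2r) up to a
   polynomial factor, whence a growth rate of (27/4)^(6/5) = 9.889...

   Building a domino by inserting the entries in increasing order, the places
   available for the next entry are described by a word over two letters, and
   cutting the word at its lowest letter "false" gives a quadratic recursion with
   one catalytic parameter for the numbers of words.  Instead of solving it, we
   iterate it numerically at z = 1/6.69 on finitely many coefficients, with
   rounding down, until the lower bounds force the generating function to
   diverge; so dominoes grow at rate at least 6.69, and 6.69^4 * 6.75^2 > 9.81^5. *)

Require Import Defs.
From Stdlib Require BinNat Nnat.
From mathcomp Require Import all_boot all_order all_fingroup all_algebra.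
From mathcomp Require ring.
From mathcomp Require Import zify.

Set Implicit Arguments. Unset Strict Implicit. Unset Printing Implicit Defensive.

(** * Dominoes as words *)

(** No asymptotic count of dominoes is used; one length [N] with many words suffices. Divergence at
    z = 1/6.69 gives, for every constant [C], some [N] with more than C * 6.685^N words. The
    polynomial losses, from choosing the split of [N] into two cells and from the binomials, amount
    in the fourth power of the count to a constant times (1 + h)^(12N); a large [C] absorbs that
    constant, so no control over [N] is needed. The chain is built from dominoes of this one size
    while its number of periods tends to infinity. Dominoes with cells of sizes b, t alternate with
    their half-turns, so that a decreasing cell always joins two cells of equal size. Reflecting in
    the antidiagonal after each gluing lets a single gluing operation serve both directions of the
    staircase. A period has 2N + rho entries, with rho about N/2, and about 6.69^(2N) * 6.75^(2 rho)
    choices: hence the exponents 4, 2 and 5 in the final comparison. The gap between 9.81 and 9.889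
    is what allows 6.69 in place of 27/4, and so a finite computation. *)

Section Stack.
Variables (T : Type) (p : pred T).

(** Stated for any predicate so that the same operations act on bare words and on states carrying
    the actual entries. *)
Fixpoint rem_low (i : nat) (s : seq T) : seq T :=
  if s is x :: s' then
    if p x then x :: rem_low i s' else if i is i'.+1 then rem_low i' s' else s
  else [::].

Fixpoint cut_high (j : nat) (s : seq T) : seq T :=
  match s, j with
  | _, 0 => s
  | [::], _ => [::]
  | x :: s', j'.+1 => cut_high (if p x then j' else j) s'
  end.

Lemma cut_high0 s : cut_high 0 s = s.
Proof. by case: s. Qed.

Lemma rem_low0 s : rem_low 0 s = s.
Proof. by elim: s => //= x s ->; case: (p x). Qed.

Lemma rem_low_cat i s1 s2 : i <= count (predC p) s1 ->
  rem_low i (s1 ++ s2) = rem_low i s1 ++ s2.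
Proof.
elim: s1 i => [|x s1 IH] [|i] //=; rewrite ?rem_low0 //.
  by case: (p x).
case: (p x) => /=; first by rewrite add0n => /IH ->.
by rewrite add1n ltnS => /IH ->.
Qed.

Lemma rem_low_catD i s1 s2 :
  rem_low (count (predC p) s1 + i) (s1 ++ s2) = filter p s1 ++ rem_low i s2.
Proof. by elim: s1 => //= x s1; case: (p x) => /= [|] ->. Qed.

Lemma cut_high_cat j s1 s2 : j <= count p s1 ->
  cut_high j (s1 ++ s2) = cut_high j s1 ++ s2.
Proof.
elim: s1 j => [|x s1 IH] [|j] //=; rewrite ?cut_high0 //.
case: (p x) => /= le_j; apply: IH => //.
Qed.

Lemma cut_high_catD j s1 s2 : 0 < j ->
  cut_high (count p s1 + j) (s1 ++ s2) = cut_high j s2.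
Proof.
case: j => // j _; elim: s1 => //= x s1 IH; rewrite addnS.
case: (p x) => /=; last by rewrite add0n -addnS.
by rewrite add1n -IH addnS.
Qed.

End Stack.

Lemma map_rem_low (T U : Type) (f : T -> U) (p : pred U) i s :
  map f (rem_low (p \o f) i s) = rem_low p i (map f s).
Proof. by elim: s i => //= x s IH [|i]; case: (p (f x)) => //=; rewrite IH. Qed.

Lemma map_cut_high (T U : Type) (f : T -> U) (p : pred U) j s :
  map f (cut_high (p \o f) j s) = cut_high p j (map f s).
Proof. by elim: s j => [|x s IH] [|i] //=. Qed.

(* [true] is a skew component of the left cell, [false] an entry of the right cell
   that may still get a larger entry to its right; the highest ones come first. *)
Definition succ_word (w : seq bool) : seq (seq bool) :=
  [seq false :: rem_low id i w | i <- iota 0 (count negb w).+1] ++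
  [seq true :: cut_high id j w | j <- iota 0 (count id w).+1].

Definition words (n : nat) : seq (seq bool) :=
  iter n (fun ws => flatten (map succ_word ws)) [:: [::]].

Lemma sum_words0 (f : seq bool -> nat) : \sum_(w <- words 0) f w = f [::].
Proof. by rewrite /words /= big_seq1. Qed.

Lemma sum_wordsS n (f : seq bool -> nat) :
  \sum_(w <- words n.+1) f w = \sum_(w <- words n) \sum_(w' <- succ_word w) f w'.
Proof. by rewrite /words iterS big_flatten big_map. Qed.

Lemma all_id_nseq (w : seq bool) : all id w -> w = nseq (size w) true.
Proof. by elim: w => //= -[] //= w IH /IH <-. Qed.

Lemma cut_high_nseq j m : cut_high id j (nseq m true) = nseq (m - j) true.
Proof. by elim: m j => [|m IH] [|j] //=. Qed.

Lemma sum_succ_high f m :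
  \sum_(w <- succ_word (nseq m true)) f w =
  f (false :: nseq m true) + \sum_(k < m.+1) f (nseq k.+1 true) :> nat.
Proof.
have c0: count negb (nseq m true) = 0 by rewrite count_nseq.
have c1: count id (nseq m true) = m by rewrite count_nseq /= mul1n.
rewrite /succ_word c0 c1 big_cat big_map big_seq1 rem_low0; congr (_ + _).
rewrite big_map -[m.+1]subn0 -/(index_iota 0 m.+1) subn0 big_mkord.
rewrite (reindex_inj rev_ord_inj) /=; apply: eq_bigr => i _.
by rewrite subSS cut_high_nseq subKn // -ltnS.
Qed.

(** Operations that stay above the lowest [false] only see [y]. The others either remove every
    [false], that one included, before pushing a new one, or cut past it and leave only letters
    [true]. *)
Lemma sum_succ_low f y m :
  \sum_(w <- succ_word (y ++ false :: nseq m true)) f w =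
  \sum_(y' <- succ_word y) f (y' ++ false :: nseq m true)
  + f (false :: nseq (count id y + m) true) + \sum_(k < m) f (nseq k.+1 true)
  :> nat.
Proof.
have E : succ_word (y ++ false :: nseq m true) =
  [seq false :: rem_low id i y ++ false :: nseq m true | i <- iota 0 (count negb y).+1]
  ++ (false :: nseq (count id y + m) true) ::
  [seq true :: cut_high id j y ++ false :: nseq m true | j <- iota 0 (count id y).+1]
  ++ [seq nseq (m - j) true | j <- iota 0 m].
  have c0: count negb (y ++ false :: nseq m true) = (count negb y).+1.
    by rewrite count_cat /= count_nseq /= addn1.
  have c1: count id (y ++ false :: nseq m true) = count id y + m.
    by rewrite count_cat /= count_nseq /= mul1n.
  rewrite /succ_word c0 c1 -[(count negb y).+2]addn1 iotaD map_cat -catA.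
  congr (_ ++ _).
    apply/eq_in_map => i; rewrite mem_iota ltnS => /andP[_ le_i].
    by rewrite rem_low_cat.
  rewrite -addSn iotaD map_cat [map _ (iota _ 1)]/= -[RHS]cat1s; congr (_ ++ _).
    congr [:: _ :: _]; rewrite add0n -addn1 rem_low_catD /= rem_low0 nseqD.
    congr (_ ++ _); rewrite -size_filter; apply: all_id_nseq; exact: filter_all.
  congr (_ ++ _).
    apply/eq_in_map => i; rewrite mem_iota ltnS => /andP[_ le_i].
    by rewrite cut_high_cat.
  rewrite add0n -[(count id y).+1]addn0 iotaDl -map_comp; apply/eq_in_map => j.
  rewrite mem_iota add0n /= => ltjm.
  rewrite addSnnS cut_high_catD //= cut_high_nseq.
  by rewrite -(subnSK ltjm).
rewrite E big_cat big_cons big_cat !big_map /succ_word big_cat !big_map.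
have -> : \sum_(j <- iota 0 m) f (nseq (m - j) true) =
          \sum_(k < m) f (nseq k.+1 true).
  rewrite -{1}[m]subn0 -/(index_iota 0 m) big_mkord (reindex_inj rev_ord_inj) /=.
  by apply: eq_bigr => i _; rewrite subKn.
by rewrite -!addnA; congr (_ + _); rewrite addnCA.
Qed.

(* A word with a letter [false] is cut at the lowest one: what lies above it is a
   word in its own right, started when that [false] was pushed, and the letters
   [true] below it are all those of the word present at that time. *)
Lemma words_decomp n (f : seq bool -> nat) :
  \sum_(w <- words n) f w =
  \sum_(w <- words n | all id w) f w +
  \sum_(a < n) \sum_(u <- words a) \sum_(y <- words (n - a.+1))
     f (y ++ false :: nseq (count id u) true).
Proof.
elim: n f => [|n IH] f.
  by rewrite big_ord0 addn0 /words /= !big_cons !big_nil.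
pose Sf g w := \sum_(w' <- succ_word w) g w'.
(* [f0] isolates the successors without [false], which arise by cutting past the lowest one; the
   others keep the lowest [false] or push a new lowest one. *)
pose f0 w := if all id w then f w else 0.
have f0_high k : f0 (nseq k true) = f (nseq k true).
  by rewrite /f0 all_nseq orbT.
have f0_sum m : \sum_(k < m) f0 (nseq k.+1 true) = \sum_(k < m) f (nseq k.+1 true).
  by apply: eq_bigr => k _; apply: f0_high.
have Sf_high w : all id w -> Sf f w = Sf f0 w + f (false :: nseq (count id w) true).
  move=> /all_id_nseq ->; rewrite /Sf !sum_succ_high f0_sum count_nseq mul1n.
  by rewrite /f0 /= add0n addnC.
have Sf_low y m : Sf f (y ++ false :: nseq m true) =
  Sf f0 (y ++ false :: nseq m true) + f (false :: nseq (count id y + m) true)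
  + \sum_(y' <- succ_word y) f (y' ++ false :: nseq m true).
  rewrite /Sf !sum_succ_low f0_sum.
  have -> : \sum_(y' <- succ_word y) f0 (y' ++ false :: nseq m true) = 0.
    by apply: big1 => y' _; rewrite /f0 all_cat /= andbF.
  have -> : f0 (false :: nseq (count id y + m) true) = 0 by [].
  lia.
pose G h := \sum_(a < n) \sum_(u <- words a) \sum_(y <- words (n - a.+1))
     h (y ++ false :: nseq (count id u) true) : nat.
have E0 : \sum_(w <- words n.+1 | all id w) f w =
   \sum_(w <- words n | all id w) Sf f0 w + G (Sf f0).
  by rewrite big_mkcond /= -/f0 sum_wordsS IH.
rewrite E0 sum_wordsS IH -/(G (Sf f)).
have -> : \sum_(w <- words n | all id w) Sf f w =
  \sum_(w <- words n | all id w) Sf f0 w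
  + \sum_(w <- words n | all id w) f (false :: nseq (count id w) true).
  by rewrite -big_split; apply: eq_bigr => w /Sf_high.
have -> : G (Sf f) = G (Sf f0) + G (fun w => f (false :: nseq (count id w) true))
  + \sum_(a < n) \sum_(u <- words a) \sum_(y <- words (n.+1 - a.+1))
     f (y ++ false :: nseq (count id u) true).
  rewrite /G -!big_split; apply: eq_bigr => a _.
  rewrite -!big_split; apply: eq_bigr => u _.
  rewrite subSn // sum_wordsS -!big_split; apply: eq_bigr => y _.
  by rewrite Sf_low count_cat /= count_nseq mul1n.
(* For [a = n] the lowest [false] has just been pushed and nothing lies above it. [E1] regroups the
   successors of this kind over all words of length [n]. *)
rewrite big_ord_recr /= subnn.
under [X in _ = _ + (_ + X)]eq_bigr => u _ do rewrite sum_words0.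
have E1 : \sum_(w <- words n) f (false :: nseq (count id w) true) =
  \sum_(w <- words n | all id w) f (false :: nseq (count id w) true)
  + G (fun w => f (false :: nseq (count id w) true)) := IH _.
by rewrite E1; lia.
Qed.

Definition nb_high (m n : nat) : nat := \sum_(w <- words n) (w == nseq m true).
Definition nb_words (m n : nat) : nat := \sum_(w <- words n) (count id w == m).

(** The letters [true] of a decomposed word come from [u] and [y], so their number, the catalytic
    parameter, splits as i + (m - i). *)
Lemma nb_wordsE m n :
  nb_words m n = nb_high m n +
  \sum_(a < n) \sum_(i < m.+1) nb_words i a * nb_words (m - i) (n - a.+1).
Proof.
rewrite /nb_words words_decomp; congr (_ + _).
  rewrite big_mkcond; apply: eq_bigr => w _; case: ifP => [/all_id_nseq Ew|].
    rewrite Ew count_nseq mul1n; congr (nat_of_bool _); apply/eqP/eqP => [->//|].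
    by move/(congr1 size); rewrite !size_nseq.
  by case: eqP => // ->; rewrite all_nseq orbT.
apply: eq_bigr => a _.
rewrite (eq_bigr (fun i : 'I_m.+1 => \sum_(u <- words a) \sum_(y <- words (n - a.+1))
   ((count id u == i) * (count id y == m - i)))); last first.
  move=> i _; rewrite /nb_words big_distrl /=; apply: eq_bigr => u _.
  by rewrite big_distrr.
rewrite [RHS]exchange_big; apply: eq_bigr => u _.
rewrite [RHS]exchange_big; apply: eq_bigr => y _ /=.
rewrite count_cat /= count_nseq mul1n add0n.
case: (leqP (count id u) m) => [le_um|lt_mu]; last first.
  rewrite big1 => [|i _]; first by case: eqP => // E; lia.
  by case: eqP => // E; have := ltn_ord i; lia.
rewrite (bigD1 (Ordinal (le_um : count id u < m.+1))) //= eqxx mul1n big1 ?addn0.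
  by congr (nat_of_bool _); apply/eqP/eqP; lia.
by move=> i; rewrite -val_eqE /= eq_sym => /negPf ->.
Qed.

Lemma nb_high0 : nb_high 0 0 = 1.
Proof. by rewrite /nb_high sum_words0. Qed.

Lemma sum_eq_nat a b s :
  \sum_(a <= k < b) (s == k) = ((a <= s < b) : nat).
Proof.
rewrite -[RHS](_ : (s \in index_iota a b : nat) = _); last by rewrite mem_index_iota.
rewrite -count_uniq_mem ?iota_uniq // -sum1_count [RHS]big_mkcond.
by apply: eq_bigr => k _; rewrite /= eq_sym; case: eqP.
Qed.

Lemma eq_high s t : (nseq s true == nseq t true) = (s == t).
Proof.
by apply/eqP/eqP => [/(congr1 size)|->//]; rewrite !size_nseq.
Qed.

(** A word of k letters [true] with k >= m, or such a block with k > m below a lowest [false], has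
    exactly one successor made of m + 1 letters [true]. The bound [M] on k keeps the sum finite for
    the computation. *)
Lemma nb_highS M m n :
  nb_high m.+1 n.+1 >= nb_high m n +
  \sum_(m.+1 <= k < M) (nb_high k n +
     \sum_(a < n) nb_words k a * size (words (n - a.+1))).
Proof.
have select k : \sum_(i < k) (nseq i.+1 true == nseq m.+1 true) = (m < k).
  under eq_bigr => i _ do rewrite eq_high eqSS eq_sym.
  by rewrite -(big_mkord xpredT (fun i => nat_of_bool (m == i))) sum_eq_nat.
have -> : nb_high m.+1 n.+1 = \sum_(w <- words n | all id w) (m <= size w) +
    \sum_(a < n) \sum_(u <- words a) \sum_(y <- words (n - a.+1)) (m < count id u).
  rewrite /nb_high sum_wordsS words_decomp; congr (_ + _).
    apply: eq_bigr => w /all_id_nseq Ew.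
    by rewrite {1}Ew sum_succ_high select.
  apply: eq_bigr => a _; apply: eq_bigr => u _; apply: eq_bigr => y _.
  rewrite sum_succ_low select big1 // => y' _; case: eqP => // /(congr1 (all id)).
  by rewrite all_cat /= andbF all_nseq orbT.
rewrite big_split /= addnA; apply: leq_add.
  rewrite /nb_high exchange_big -big_split /= big_mkcond [X in _ <= X]big_mkcond /=.
  apply: leq_sum => w _; case: ifP => [/all_id_nseq ->|not_high].
    rewrite eq_high (eq_bigr (fun k => (size w == k) : nat)); last first.
      by move=> k _; rewrite eq_high.
    by rewrite sum_eq_nat size_nseq; lia.
  have ne k : w == nseq k true = false.
    by apply/negP => /eqP Ew; rewrite Ew all_nseq orbT in not_high.
  by rewrite ne big1 // => k _; rewrite ne.
rewrite exchange_big; apply: leq_sum => a _ /=.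
rewrite -big_distrl /= /nb_words exchange_big big_distrl /=; apply: leq_sum => u _.
rewrite big_const_seq count_predT iter_addn addn0 leq_mul2r.
by rewrite sum_eq_nat; apply/orP; right; lia.
Qed.

(** * Growth rate of the number of words *)

Section Growth.
Import ring.
Import Order.TTheory GRing.Theory Num.Theory.
Local Open Scope ring_scope.

Section PartialSums.
Variables (z : rat) (z_ge0 : 0 <= z).

Definition psum (f : nat -> nat) (n : nat) : rat := \sum_(i < n) (f i)%:R * z ^+ i.

Lemma psum_ge0 f n : 0 <= psum f n.
Proof. by apply: sumr_ge0 => i _; rewrite mulr_ge0 ?exprn_ge0 ?ler0n. Qed.

Lemma psum_le f n n' : (n <= n')%N -> psum f n <= psum f n'.
Proof.
move=> le_nn; rewrite -(subnKC le_nn) /psum big_split_ord /= lerDl.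
by apply: sumr_ge0 => i _; rewrite mulr_ge0 ?exprn_ge0 ?ler0n.
Qed.

(** Partial sums are values of polynomials, and a product of two truncations has coefficients at
    most those of the full convolution. *)
Lemma psum_conv (f g : nat -> nat) n :
  psum f n * psum g n <= psum (fun k => \sum_(a < k.+1) f a * g (k - a))%N (n + n).
Proof.
pose p h := \poly_(i < n) (h i)%:R : {poly rat}.
have evp h : psum h n = (p h).[z].
  by rewrite horner_poly.
rewrite !evp -hornerM (@horner_coef_wide _ (n + n)%N).
  apply: ler_sum => k _; rewrite ler_wpM2r ?exprn_ge0 // coefM natr_sum.
  apply: ler_sum => a _; rewrite !coef_poly natrM.
  by case: ifP => _; case: ifP => _; rewrite ?mul0r ?mulr0 ?mulr_ge0 ?ler0n.
apply: leq_trans (size_polyMleq _ _) _.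
by apply: leq_trans (leq_pred _) _; apply: leq_add; apply: size_poly.
Qed.

Lemma psum_conv_le (h e f g : nat -> nat) n n' : (n + n < n')%N ->
  (forall k, e k + \sum_(a < k) f a * g (k - a.+1) <= h k)%N ->
  psum e n' + z * (psum f n * psum g n) <= psum h n'.
Proof.
move=> lt_nn' le_h.
pose c k := (\sum_(a < k) f a * g (k - a.+1))%N.
apply: (@le_trans _ _ (psum e n' + psum c n')); last first.
  rewrite /psum -big_split /=; apply: ler_sum => k _.
  by rewrite -mulrDl ler_wpM2r ?exprn_ge0 // -natrD ler_nat.
rewrite lerD2l; case: n' lt_nn' => // n'; rewrite ltnS => le_nn'.
have -> : psum c n'.+1 = z * psum (fun k => \sum_(a < k.+1) f a * g (k - a))%N n'.
  rewrite /psum big_ord_recl {1}/c big_ord0 mul0r add0r mulr_sumr.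
  by apply: eq_bigr => k _; rewrite lift0 exprS mulrCA.
by rewrite ler_wpM2l //; apply: le_trans (psum_conv f g n) (psum_le _ le_nn').
Qed.

Lemma psumS_le (h e : nat -> nat) n n' : (n < n')%N ->
  (forall k, e k <= h k.+1)%N -> z * psum e n <= psum h n'.
Proof.
move=> lt_nn' le_h; apply: le_trans (psum_le h lt_nn').
rewrite /psum big_ord_recl mulr_sumr ler_wpDl ?mulr_ge0 ?exprn_ge0 ?ler0n //.
apply: ler_sum => k _; rewrite lift0 exprS mulrCA ler_wpM2r ?mulr_ge0 ?exprn_ge0 //.
by rewrite ler_nat.
Qed.


Definition psum_high m := psum (nb_high m).
Definition psum_words m := psum (nb_words m).
Definition psum_all := psum (fun k => size (words k)).

Lemma psum_high0 n : (0 < n)%N -> 1 <= psum_high 0 n.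
Proof.
move=> n_gt0; apply: le_trans (psum_le _ n_gt0).
by rewrite /psum big_ord1 nb_high0 mulr1.
Qed.

Lemma sum_nb_words M k : (\sum_(m < M) nb_words m k <= size (words k))%N.
Proof.
rewrite exchange_big -sum1_size; apply: leq_sum => w _ /=.
rewrite -(big_mkord xpredT (fun m => nat_of_bool (count id w == m))) sum_eq_nat.
by case: (_ <= _ < _)%N.
Qed.

Lemma psum_all_ge M n : \sum_(m < M) psum_words m n <= psum_all n.
Proof.
rewrite /psum_words /psum exchange_big; apply: ler_sum => k _ /=.
by rewrite -mulr_suml ler_wpM2r ?exprn_ge0 ?z_ge0 // -natr_sum ler_nat sum_nb_words.
Qed.

Lemma psum_wordsS m n n' : (n + n < n')%N ->
  psum_high m n' + z * \sum_(i < m.+1) psum_words i n * psum_words (m - i) n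
  <= psum_words m n'.
Proof.
move=> lt_nn'.
pose c k := (\sum_(a < k) \sum_(i < m.+1) nb_words i a * nb_words (m - i) (k - a.+1))%N.
have -> : psum_words m n' = psum_high m n' +
    \sum_(i < m.+1) psum (fun k => \sum_(a < k) nb_words i a * nb_words (m - i) (k - a.+1))%N n'.
  rewrite /psum_words /psum_high /psum exchange_big -big_split; apply: eq_bigr => k _ /=.
  by rewrite nb_wordsE exchange_big /= natrD [X in (_ + X) * _]natr_sum mulrDl mulr_suml.
rewrite lerD2l mulr_sumr; apply: ler_sum => i _.
have := @psum_conv_le _ (fun=> 0%N) (nb_words i) (nb_words (m - i)) n n' lt_nn'
  (fun k => leqnn _).
by rewrite [X in X + _]big1 ?add0r // => k _; rewrite mul0r.
Qed.

Lemma psum_highS M m n n' : (n.*2.+1 < n')%N ->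
  z * (psum_high m n + \sum_(m.+1 <= k < M)
          (psum_high k n + z * (psum_words k n * psum_all n)))
  <= psum_high m.+1 n'.
Proof.
case: n' => // n'; rewrite ltnS => lt_nn'.
apply: le_trans (psumS_le (ltnSn n') (nb_highS M m)).
pose e j k := (nb_high j k + \sum_(a < k) nb_words j a * size (words (k - a.+1)))%N.
have -> : psum (fun k => nb_high m k + \sum_(m.+1 <= j < M) e j k)%N n' =
    psum_high m n' + \sum_(m.+1 <= j < M) psum (e j) n'.
  rewrite /psum_high /psum exchange_big -big_split; apply: eq_bigr => k _ /=.
  by rewrite natrD [X in (_ + X) * _]natr_sum mulrDl mulr_suml.
rewrite ler_wpM2l // lerD //; first by apply: psum_le; lia.
apply: ler_sum => k _; rewrite -addnn in lt_nn'.
have := @psum_conv_le _ (nb_high k) (nb_words k) (fun j => size (words j)) n n' lt_nn'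
  (fun k => leqnn _).
apply: le_trans; rewrite lerD2r; apply: psum_le _ _; lia.
Qed.

(** From [words_decomp] with f = 1, keeping the empty word and all the words that contain [false].
    This is what turns a large partial sum into divergence. *)
Lemma psum_allS n n' : (n + n < n')%N -> 1 + z * psum_all n ^+ 2 <= psum_all n'.
Proof.
move=> lt_nn'.
pose sz k := size (words k).
have le_h (k : nat) : ((k == 0) + \sum_(a < k) size (words a) * size (words (k - a.+1))
              <= size (words k))%N.
  rewrite -[leqRHS]sum1_size words_decomp; apply: leq_add.
    by case: k => //=; rewrite /words /= big_cons big_nil.
  apply: leq_sum => a _.
  under [leqRHS]eq_bigr => u _ do rewrite sum1_size.
  by rewrite big_const_seq count_predT iter_addn addn0 mulnC.
rewrite expr2.
apply: le_trans (@psum_conv_le _ (fun k => (k == 0)%N) sz sz _ _ lt_nn' le_h).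
rewrite lerD2r; case: n' lt_nn' => // n' _.
rewrite /psum big_ord_recl mul1r lerDl; apply: sumr_ge0 => i _.
by rewrite mulr_ge0 ?exprn_ge0 ?z_ge0 ?ler0n.
Qed.

End PartialSums.

(** * Certified lower bounds by integer iteration *)

Section Iteration.
Local Notation N := BinNums.N.
Local Infix "+!" := BinNat.N.add (at level 50, left associativity).
Local Infix "*!" := BinNat.N.mul (at level 40, left associativity).
Local Infix "/!" := BinNat.N.div (at level 40, left associativity).
Local Notation toN := BinNat.N.to_nat.
Variables (scale num den : N) (M : nat).

Fixpoint dot (p q : seq N) : N :=
  match p, q with
  | x :: p', y :: q' => x *! y +! dot p' q'
  | _, _ => BinNums.N0
  end.

(** Truncated square of a coefficient list: [r] holds the part already read, reversed, so that [dot]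
    pairs index i with index m - i. *)
Fixpoint self_conv (q r p : seq N) : seq N :=
  if p is x :: p' then dot (x :: r) q :: self_conv q (x :: r) p' else [::].

(** The recursion returns from the highest index down; the second component is the tail sum of
    [nb_highS], so all tails are found in one pass. Here [s] bounds the series of all words. *)
Fixpoint next_high (s : N) (x p : seq N) : seq N * N :=
  match x, p with
  | a :: x', b :: p' =>
      let: (l, t) := next_high s x' p' in
      (num *! (a +! t) /! den :: l, a +! num *! (b *! s) /! (den *! scale) +! t)
  | _, _ => ([::], BinNums.N0)
  end.

Fixpoint add_conv (x c : seq N) : seq N :=
  match x, c with
  | a :: x', b :: c' => (a +! num *! b /! (den *! scale)) :: add_conv x' c'
  | _, _ => x
  end.

Definition sumN (p : seq N) : N := foldr BinNat.N.add BinNums.N0 p.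

(* The entries are numerators over [scale] of lower bounds for the partial sums
   at [z = num / den] of the series of [nb_high m] and [nb_words m]. *)
Definition next_bounds (xp : seq N * seq N) : seq N * seq N :=
  let: (x, p) := xp in
  let x' := take M (scale :: (next_high (sumN p) x p).1) in
  (x', add_conv x' (self_conv p [::] p)).

Fixpoint blows_up (fuel : nat) (xp : seq N * seq N) : bool :=
  if BinNat.N.leb (den *! scale) (num *! sumN xp.2) then true
  else if fuel is fuel'.+1 then blows_up fuel' (next_bounds xp) else false.

Hypotheses (scale_gt0 : (0 < toN scale)%N) (den_gt0 : (0 < toN den)%N).

Let z : rat := (toN num)%:R / (toN den)%:R.
Let val (x : N) : rat := (toN x)%:R / (toN scale)%:R.

Lemma toND x y : toN (x +! y) = (toN x + toN y)%N.
Proof. exact: Nnat.N2Nat.inj_add. Qed.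
Lemma toNM x y : toN (x *! y) = (toN x * toN y)%N.
Proof. exact: Nnat.N2Nat.inj_mul. Qed.
Lemma z_ge0 : 0 <= z. Proof. by rewrite divr_ge0 ?ler0n. Qed.
Lemma val_ge0 x : 0 <= val x. Proof. by rewrite divr_ge0 ?ler0n. Qed.
Lemma val0 : val BinNums.N0 = 0. Proof. by rewrite /val mul0r. Qed.
Lemma valD x y : val (x +! y) = val x + val y.
Proof. by rewrite /val toND natrD mulrDl. Qed.

Lemma toN_div x y : (0 < toN y)%N -> (toN (x /! y) * toN y <= toN x)%N.
Proof.
move=> y_gt0; have y_neq0 : y <> BinNums.N0 by move=> y0; rewrite y0 in y_gt0.
rewrite {2}(BinNat.N.div_mod x y y_neq0) toND toNM mulnC.
exact: leq_addr.
Qed.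

Lemma val_div x : val (num *! x /! den) <= z * val x.
Proof.
rewrite /val /z mulrA ler_pM2r ?invr_gt0 ?ltr0n // mulrAC ler_pdivlMr ?ltr0n //.
by have := toN_div (num *! x) den_gt0; rewrite toNM -!natrM ler_nat.
Qed.

Lemma val_div2 c :
  val (num *! c /! (den *! scale)) <= z * ((toN c)%:R / (toN scale)%:R / (toN scale)%:R).
Proof.
have s0 : (toN scale)%:R != 0 :> rat by rewrite pnatr_eq0 -lt0n.
have d0 : (toN den)%:R != 0 :> rat by rewrite pnatr_eq0 -lt0n.
rewrite /val /z ler_pdivrMr ?ltr0n //.
have -> : (toN num)%:R / (toN den)%:R * ((toN c)%:R / (toN scale)%:R / (toN scale)%:R)
    * (toN scale)%:R = (toN num * toN c)%:R / (toN den * toN scale)%:R :> rat.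
  by rewrite !natrM; field; rewrite s0 d0.
rewrite ler_pdivlMr ?ltr0n ?muln_gt0 ?scale_gt0 ?den_gt0 // -natrM ler_nat.
have := @toN_div (num *! c) (den *! scale).
by rewrite !toNM muln_gt0 den_gt0; apply.
Qed.

Lemma val_mul x y :
  (toN x * toN y)%:R / (toN scale)%:R / (toN scale)%:R = val x * val y.
Proof. by rewrite natrM /val mulrACA mulrA. Qed.

Let bound (l : seq N) (f : nat -> rat) := forall m, val (nth BinNums.N0 l m) <= f m.

Lemma val_sumN p : val (sumN p) = \sum_(m < size p) val (nth BinNums.N0 p m).
Proof.
elim: p => [|a p IH]; first by rewrite big_ord0 val0.
by rewrite /= valD IH big_ord_recl.
Qed.

Lemma toN_dot p q :
  toN (dot p q) = (\sum_(i < size p) toN (nth BinNums.N0 p i) * toN (nth BinNums.N0 q i))%N.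
Proof.
elim: p q => [|x p IH] [|y q] /=; rewrite ?big_ord0 //.
  by rewrite big1 // => i _; rewrite nth_nil muln0.
by rewrite toND toNM IH big_ord_recl.
Qed.

Lemma nth_self_conv q r p m : (m < size p)%N ->
  nth BinNums.N0 (self_conv q r p) m = dot (rev (take m.+1 p) ++ r) q.
Proof.
elim: p r m => // x p IH r [|m] /=; first by rewrite take0.
by rewrite ltnS => /IH ->; rewrite rev_cons cat_rcons.
Qed.

Lemma size_self_conv q r p : size (self_conv q r p) = size p.
Proof. by elim: p r => //= x p IH r; rewrite IH. Qed.

Lemma toN_self_conv p m : (m < size p)%N ->
  toN (nth BinNums.N0 (self_conv p [::] p) m) =
  (\sum_(i < m.+1) toN (nth BinNums.N0 p i) * toN (nth BinNums.N0 p (m - i)))%N.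
Proof.
move=> lt_mp; have sz : size (take m.+1 p) = m.+1 by rewrite size_takel.
rewrite nth_self_conv // cats0 toN_dot size_rev sz; apply: eq_bigr => i _.
rewrite mulnC nth_rev ?sz // subSS nth_take //; lia.
Qed.

Lemma val_self_conv p m (f : nat -> rat) : (forall i, 0 <= f i) -> bound p f ->
  val (num *! nth BinNums.N0 (self_conv p [::] p) m /! (den *! scale)) <=
  z * \sum_(i < m.+1) f i * f (m - i)%N.
Proof.
move=> f_ge0 le_pf; apply: le_trans (val_div2 _) _; rewrite ler_wpM2l ?z_ge0 //.
case: (ltnP m (size p)) => [lt_mp|le_pm]; last first.
  rewrite nth_default ?size_self_conv // !mul0r.
  by apply: sumr_ge0 => i _; rewrite mulr_ge0.
rewrite toN_self_conv // natr_sum !mulr_suml; apply: ler_sum => i _.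
by rewrite val_mul ler_pM ?val_ge0.
Qed.

(** The offset [m] is the index of the head of the lists; it makes the induction on a suffix
    possible. *)
Lemma bound_next_high x p s m k n n' :
  size p = size x -> (m + size x = k)%N -> (n.*2.+1 < n')%N ->
  (forall i, val (nth BinNums.N0 x i) <= psum_high z (m + i) n) ->
  (forall i, val (nth BinNums.N0 p i) <= psum_words z (m + i) n) ->
  val s <= psum_all z n ->
  (forall i, val (nth BinNums.N0 (next_high s x p).1 i) <= psum_high z (m + i).+1 n') /\
  val (next_high s x p).2 <=
    \sum_(m <= j < k) (psum_high z j n + z * (psum_words z j n * psum_all z n)).
Proof.
move=> szp; have zge0 := z_ge0; elim: x p m szp => [|a x IH] [|b p] // m.
  move=> _ <- _ _ _ _; split=> [i|]; rewrite /= ?addn0 ?big_geq // ?nth_nil val0 //.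
  by apply: psum_ge0.
move=> [szp] Em lt_nn' le_x le_p le_s /=.
have Em' : (m.+1 + size x = k)%N by rewrite addSnnS.
have hx i : val (nth BinNums.N0 x i) <= psum_high z (m.+1 + i) n.
  by have := le_x i.+1; rewrite addSnnS.
have hp i : val (nth BinNums.N0 p i) <= psum_words z (m.+1 + i) n.
  by have := le_p i.+1; rewrite addSnnS.
have := IH p m.+1 szp Em' lt_nn' hx hp le_s.
case: (next_high s x p) => l t /= [le_l le_t].
have lt_mk : (m < k)%N by rewrite -Em /= addnS ltnS leq_addr.
split=> [[|i]|] /=.
- apply: le_trans (val_div _) _; rewrite addn0.
  apply: le_trans _ (psum_highS zge0 k m lt_nn').
  rewrite ler_wpM2l // valD lerD //.
  by have := le_x 0%N; rewrite addn0.
- by have := le_l i; rewrite addSnnS.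
rewrite !valD big_ltn // lerD // lerD //; first by have := le_x 0%N; rewrite addn0.
apply: le_trans (val_div2 _) _; rewrite ler_wpM2l // toNM val_mul.
by have := le_p 0%N; rewrite addn0 => le_b; rewrite ler_pM ?val_ge0.
Qed.

(** The number [n] of terms is left existential: each round roughly doubles it, and only the
    existence of a large partial sum matters. *)
Definition sound (xp : seq N * seq N) : Prop :=
  exists n, [/\ size xp.2 = size xp.1, bound xp.1 (fun m => psum_high z m n)
    & bound xp.2 (fun m => psum_words z m n)].

Lemma sound_sum xp : sound xp -> exists n, val (sumN xp.2) <= psum_all z n.
Proof.
move=> [n [_ _ le_p]]; exists n; rewrite val_sumN.
by apply: le_trans (psum_all_ge z_ge0 (size xp.2) n); apply: ler_sum => m _.
Qed.

Lemma size_add_conv x c : size (add_conv x c) = size x.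
Proof. by elim: x c => [|a x IH] [|b c] //=; rewrite IH. Qed.

Lemma val_add_conv x c m :
  val (nth BinNums.N0 (add_conv x c) m) <=
  val (nth BinNums.N0 x m) + val (num *! nth BinNums.N0 c m /! (den *! scale)).
Proof.
elim: x c m => [|a x IH] [|b c] [|m] //=; rewrite ?valD ?nth_nil ?lerDl ?val_ge0 //.
Qed.

Lemma sound_next_bounds xp : sound xp -> sound (next_bounds xp).
Proof.
case: xp => x p snd_xp; have [n /= [szp le_x le_p]] := snd_xp.
have le_s : val (sumN p) <= psum_all z n.
  by rewrite val_sumN; apply: le_trans (psum_all_ge z_ge0 (size p) n); apply: ler_sum => m _.
pose n1 := n.*2.+2; exists n1; rewrite /next_bounds /= size_add_conv.
set x' := take M _.
have le_x' : bound x' (fun m => psum_high z m n1).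
  move=> m; rewrite /x'; case: (ltnP m M) => [lt_mM|le_Mm]; last first.
    by rewrite nth_default ?val0 ?psum_ge0 ?z_ge0 // size_take; case: ltnP; lia.
  rewrite nth_take //; case: m {lt_mM} => [|m] /=.
    apply: le_trans _ (psum_high0 z_ge0 (isT : 0 < n1)%N).
    by rewrite /val divff // pnatr_eq0 -lt0n.
  have [le_l _] := @bound_next_high x p (sumN p) 0 (size x) n n1 szp (add0n _)
    (ltnSn _) le_x le_p le_s.
  exact: le_l.
split=> // m; apply: le_trans (val_add_conv _ _ _) _.
have lt_nn1 : (n + n < n1)%N by rewrite /n1; lia.
apply: le_trans _ (psum_wordsS z_ge0 m lt_nn1).
rewrite lerD //; apply: (@val_self_conv p m (fun i => psum_words z i n)) => // i.
exact: psum_ge0 z_ge0 _ _.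
Qed.

Lemma blows_upP fuel xp : sound xp -> blows_up fuel xp ->
  exists n, 1 <= z * psum_all z n.
Proof.
move=> snd_xp; elim: fuel xp snd_xp => [|fuel IH] xp snd_xp /=;
  case: ifP => [/BinNat.N.leb_le le_s _|_] //; last by apply: IH; apply: sound_next_bounds.
all: have [n le_n] := sound_sum snd_xp; exists n.
all: apply: le_trans (ler_wpM2l z_ge0 le_n); rewrite /z /val mulrACA -invfM.
all: rewrite ler_pdivlMr ?mulr_gt0 ?ltr0n // mul1r -!natrM ler_nat -!toNM.
all: by rewrite -(BinNat.N.sub_add _ _ le_s) toND leq_addl.
Qed.

End Iteration.

(** * From divergence to growth *)

Lemma psum_all_blowup (z : rat) : 0 <= z -> (exists n, 1 <= z * psum_all z n) ->
  forall k : nat, exists n, k%:R <= psum_all z n.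
Proof.
move=> z_ge0 [n0 le_n0] k.
have [n _ le_k] : exists2 n, (n0 <= n)%N & k%:R <= psum_all z n.
  elim: k => [|k [n le_n0n le_kn]]; first by exists n0; rewrite ?psum_ge0.
  exists (n + n).+1; first lia.
  apply: le_trans _ (psum_allS z_ge0 (ltnSn _)).
  (* Past this threshold, 1 + z W^2 >= 1 + W, so each application of [psum_allS] adds at least 1. *)
  have le_n : 1 <= z * psum_all z n.
    by apply: le_trans le_n0 _; rewrite ler_wpM2l ?psum_le.
  have := psum_ge0 z_ge0 (fun k => size (words k)) n; rewrite -/(psum_all z n) => ge0.
  rewrite -addn1 natrD addrC lerD2l expr2 mulrA; apply: le_trans le_kn _.
  by rewrite ler_peMl.
by exists n.
Qed.

(* With 30 coefficients and a scale of 10^10, about 250 iterations suffice. *)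
Lemma words_blowup : let z : rat := 100%:R / 669%:R in exists n, 1 <= z * psum_all z n.
Proof.
pose scale := BinNat.N.pow (BinNat.N.of_nat 10) (BinNat.N.of_nat 10).
have toN_gt0 x : x <> BinNums.N0 -> (0 < BinNat.N.to_nat x)%N.
  by move=> ne; rewrite lt0n; apply/eqP => x0; apply: ne; rewrite -[x]Nnat.N2Nat.id x0.
have scale_gt0 : (0 < BinNat.N.to_nat scale)%N by apply: toN_gt0.
have den_gt0 : (0 < BinNat.N.to_nat (BinNat.N.of_nat 669))%N by apply: toN_gt0.
have := @blows_upP scale (BinNat.N.of_nat 100) (BinNat.N.of_nat 669) 30 scale_gt0 den_gt0
  400 ([::], [::]).
(* The rounds are evaluated by the virtual machine when the kernel checks the finished term. *)
rewrite !Nnat.Nat2N.id; apply; last by vm_cast_no_check (erefl true).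
by exists 0; split=> // m; rewrite nth_nil val0 psum_ge0 // divr_ge0 ?ler0n.
Qed.

(** Otherwise the series at z would be dominated by C times a geometric series of ratio q < 1 and
    its partial sums would stay below C / (1 - q). *)
Lemma growth_of_blowup (z : rat) (u v : nat) : 0 <= z -> (0 < v)%N ->
    u%:R / v%:R * z < 1 -> (exists n, 1 <= z * psum_all z n) ->
  forall C : nat, exists n, (C * u ^ n < v ^ n * size (words n))%N.
Proof.
move=> z_ge0 v_gt0; set q := _ * z => q_lt1 blowup C.
have q_ge0 : 0 <= q by rewrite mulr_ge0 ?divr_ge0 ?ler0n.
have q1_gt0 : 0 < 1 - q by rewrite subr_gt0.
have b_ge0 : 0 <= C%:R / (1 - q) by rewrite divr_ge0 ?ler0n ?ltW.
have [n le_n] := psum_all_blowup z_ge0 blowup (Num.bound (C%:R / (1 - q))).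
case: (boolP [exists k : 'I_n, (C * u ^ k < v ^ k * size (words k))%N]).
  by case/existsP=> k lt_k; exists k.
rewrite negb_exists => /forallP small.
suff : psum_all z n <= C%:R / (1 - q).
  by move=> /(le_trans le_n); rewrite leNgt archi_boundP.
have term (k : 'I_n) : (size (words k))%:R * z ^+ k <= C%:R * q ^+ k.
  have := small k; rewrite -leqNgt -(ler_nat rat) !natrM !natrX => le_k.
  rewrite /q exprMn mulrA ler_wpM2r ?exprn_ge0 // expr_div_n mulrA.
  by rewrite ler_pdivlMr ?exprn_gt0 ?ltr0n // mulrC.
apply: le_trans (ler_sum _ (fun k _ => term k)) _.
rewrite -mulr_sumr ler_wpM2l ?ler0n //.
have E : (1 - q) * (\sum_(k < n) q ^+ k) = 1 - q ^+ n.
  by rewrite -[1 - q]opprB mulNr -subrX1 opprB.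
rewrite -(ler_pM2l q1_gt0) E divff ?gt_eqF //.
by rewrite gerBl exprn_ge0.
Qed.

(** The rate 1337/200 = 6.685 is just below 1/z = 6.69, which makes the geometric ratio
    1337/1338. *)
Lemma words_growth (C : nat) : exists n, (C * 1337 ^ n < 200 ^ n * size (words n))%N.
Proof.
have z_ge0 : 0 <= 100%:R / 669%:R :> rat by rewrite divr_ge0 ?ler0n.
have q_lt1 : 1337%:R / 200%:R * (100%:R / 669%:R) < 1 :> rat.
  have -> : 1337%:R / 200%:R * (100%:R / 669%:R) = 1337%:R / 1338%:R :> rat by field.
  have d_gt0 : 0 < 1338%:R :> rat by rewrite ltr0n.
  rewrite (ltr_pdivrMr _ _ d_gt0) mul1r ltr_nat; exact: isT.
exact: (growth_of_blowup z_ge0 (isT : (0 < 200)%N) q_lt1 words_blowup C).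
Qed.

End Growth.

(** * Construction of dominoes *)

Definition av132 (l : seq nat) := forall a b c, subseq [:: a; b; c] l -> ~ a < c < b.
Definition av213 (l : seq nat) := forall a b c, subseq [:: a; b; c] l -> ~ b < a < c.
Definition av1324 (l : seq nat) :=
  forall a b c d, subseq [:: a; b; c; d] l -> ~ [&& a < c, c < b & b < d].

Lemma av132_sub l l' : subseq l' l -> av132 l -> av132 l'.
Proof. by move=> sub av a b c /subseq_trans/(_ sub)/av. Qed.

Lemma subseq_catP (T : eqType) (s l1 l2 : seq T) : subseq s (l1 ++ l2) ->
  exists s1 s2, [/\ s = s1 ++ s2, subseq s1 l1 & subseq s2 l2].
Proof.
case/subseqP=> m sz_m ->; exists (mask (take (size l1) m) l1), (mask (drop (size l1) m) l2).
rewrite -mask_cat ?cat_take_drop ?mask_subseq // size_takel // sz_m size_cat; exact: leq_addr.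
Qed.

Lemma subseq_insP (T : eqType) (x : T) s l1 l2 : subseq s (l1 ++ x :: l2) ->
  subseq s (l1 ++ l2) \/
  exists s1 s2, [/\ s = s1 ++ x :: s2, subseq s1 l1 & subseq s2 l2].
Proof.
move=> /subseq_catP[s1 [s2 [-> sub1]]] /=; case: s2 => [|y s2].
  by left; rewrite cats0; apply: subseq_trans sub1 (prefix_subseq _ _).
case: eqP => [->|_] sub2; first by right; exists s1, s2.
by left; apply: cat_subseq.
Qed.

Lemma subseq1_mem (T : eqType) (x : T) s t : subseq s t -> x \in s -> x \in t.
Proof. by move=> /mem_subseq; apply. Qed.

(** * Inserting a new maximum *)

Section InsertMax.
Variables (l1 l2 : seq nat) (n : nat).
Hypothesis max_n : forall x, x \in l1 ++ l2 -> x < n.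

(** A maximum can only play the 4, and then a 132 stands to its left. *)
Lemma av1324_ins : av1324 (l1 ++ l2) -> av132 l1 -> av1324 (l1 ++ n :: l2).
Proof.
move=> av av1 a b c d sub /and3P[ac cb bd]; case: (subseq_insP sub) => [/av|].
  by rewrite ac cb bd; apply.
case=> s1 [s2 [E sub1 sub2]].
have lt2 x : x \in s2 -> x < n.
  by move=> xs2; apply: max_n; rewrite mem_cat (subseq1_mem sub2 xs2) orbT.
have lt1 x : x \in s1 -> x < n.
  by move=> xs1; apply: max_n; rewrite mem_cat (subseq1_mem sub1 xs1).
case: s1 E sub1 lt1 => [|x1 [|x2 [|x3 [|x4 s1]]]] [] Ea.
- by move=> E2; have := lt2 d; rewrite -E2 !inE eqxx !orbT => /(_ isT); lia.
- by move=> Eb E2; have := lt2 d; rewrite -E2 !inE eqxx !orbT => /(_ isT); lia.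
- by move=> Eb Ec E2; have := lt2 d; rewrite -E2 !inE eqxx => /(_ isT); lia.
- by move=> Eb Ec _ _ sub1 _; apply: (av1 x1 x2 x3) => //; lia.
- by move=> Eb Ec Ed; case: s1.
Qed.

Lemma av132_ins : av132 (l1 ++ l2) -> (forall x y, x \in l1 -> y \in l2 -> y < x) ->
  av132 (l1 ++ n :: l2).
Proof.
move=> av gt12 a b c sub /andP[ac cb]; case: (subseq_insP sub) => [/av|].
  by rewrite ac cb; apply.
case=> s1 [s2 [E sub1 sub2]].
have lt2 x : x \in s2 -> x < n.
  by move=> xs2; apply: max_n; rewrite mem_cat (subseq1_mem sub2 xs2) orbT.
have lt1 x : x \in s1 -> x < n.
  by move=> xs1; apply: max_n; rewrite mem_cat (subseq1_mem sub1 xs1).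
case: s1 E sub1 lt1 => [|x1 [|x2 [|x3 s1]]] [] Ea.
- by move=> E2; have := lt2 b; rewrite -E2 !inE eqxx => /(_ isT); lia.
- move=> Eb E2 sub1 _; have := gt12 a c; rewrite (subseq1_mem sub1) ?Ea ?inE //.
  by rewrite (subseq1_mem sub2) -?E2 ?inE // => /(_ isT isT); lia.
- by move=> Eb En _ _ lt1; have := lt1 b; rewrite Eb !inE eqxx orbT => /(_ isT); lia.
- by move=> Eb Ec; case: s1.
Qed.

Lemma av213_ins : av213 (l1 ++ l2) -> (forall x y, subseq [:: x; y] l1 -> x < y) ->
  av213 (l1 ++ n :: l2).
Proof.
move=> av incr1 a b c sub /andP[ba ac]; case: (subseq_insP sub) => [/av|].
  by rewrite ba ac; apply.
case=> s1 [s2 [E sub1 sub2]].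
have lt2 x : x \in s2 -> x < n.
  by move=> xs2; apply: max_n; rewrite mem_cat (subseq1_mem sub2 xs2) orbT.
case: s1 E sub1 => [|x1 [|x2 [|x3 s1]]] [] Ea.
- by move=> E2; have := lt2 c; rewrite -E2 !inE eqxx orbT => /(_ isT); lia.
- by move=> Eb E2; have := lt2 c; rewrite -E2 !inE eqxx => /(_ isT); lia.
- by move=> Eb Ec _ /incr1; lia.
- by move=> Eb Ec; case: s1.
Qed.
End InsertMax.

(* A state of the construction: the entries of the left cell grouped into the
   skew components, and the entries of the right cell next to which a larger
   entry may still be inserted, listed from the largest to the smallest values;
   a marked item is a component. *)
Definition item := (bool * seq nat)%type.

(** Skew components descend to the right, so [lefts] keeps the order of the items; the open entries
    of the right cell form an increasing run, so [lows] reverses it. *)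
Definition lefts (s : seq item) : seq nat := flatten [seq x.2 | x <- s & x.1].
Definition lows (s : seq item) : seq nat :=
  flatten (rev [seq x.2 | x <- s & ~~ x.1]).

Lemma lefts_cons x s : lefts (x :: s) = (if x.1 then x.2 else [::]) ++ lefts s.
Proof. by rewrite /lefts /=; case: x.1. Qed.

Lemma lefts_cat s t : lefts (s ++ t) = lefts s ++ lefts t.
Proof. by rewrite /lefts filter_cat map_cat flatten_cat. Qed.

Lemma lows_cons x s : lows (x :: s) = lows s ++ (if x.1 then [::] else x.2).
Proof. by rewrite /lows /=; case: x.1; rewrite ?cats0 //= rev_cons flatten_rcons. Qed.

Definition above (x y : item) := allrel (fun u v => v < u) x.2 y.2.

Definition wf (s : seq item) : bool :=
  pairwise above s && all (fun x => if x.1 then x.2 != [::] else size x.2 == 1) s.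

Lemma wf_cons x s : wf (x :: s) =
  [&& all (above x) s, (if x.1 then x.2 != [::] else size x.2 == 1) & wf s].
Proof. by rewrite /wf /= andbACA -!andbA. Qed.

Lemma wf_sub s t : subseq s t -> wf t -> wf s.
Proof.
move=> sub /andP[pw al]; rewrite /wf (subseq_pairwise sub pw).
by apply/allP => x /(mem_subseq sub)/(allP al).
Qed.

Lemma above_lefts x s u v : all (above x) s -> u \in x.2 -> v \in lefts s -> v < u.
Proof.
move=> /allP ab ux /flattenP[t /mapP[y]]; rewrite mem_filter => /andP[_ ys] -> vy.
by have /allrelP := ab _ ys; apply.
Qed.

Lemma above_lows x s u v : all (above x) s -> u \in x.2 -> v \in lows s -> v < u.
Proof.
move=> /allP ab ux /flattenP[t]; rewrite mem_rev => /mapP[y].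
rewrite mem_filter => /andP[_ ys] -> vy.
by have /allrelP := ab _ ys; apply.
Qed.

Lemma lows_incr s u v : wf s -> subseq [:: u; v] (lows s) -> u < v.
Proof.
elim: s => // x s IH; rewrite wf_cons lows_cons => /and3P[ab ok wf_s].
case: ifP ok => [_ _|_ /eqP]; first by rewrite cats0; apply: IH.
case: x ab => x1 [|y []] //= ab _ /subseq_catP[[|u1 [|u2 s1]] [s2 [/= E sub1 sub2]]].
- by rewrite -E in sub2; case: ifP sub2.
- case: E sub2 sub1 => <- <- /=; rewrite sub1seq; case: ifP => [/eqP -> _|//] us.
  by apply: above_lows ab _ us; rewrite inE.
- by case: E sub1 => <- <-; case: s1 => // _; apply: IH.
Qed.

(** An ascent of [lefts] lies within one component, and every other item is entirely above or
    entirely below that component. *)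
Lemma lefts_lows s u v c : wf s -> subseq [:: u; v] (lefts s) -> c \in lows s ->
  ~ u < c < v.
Proof.
elim: s => // x s IH; rewrite wf_cons lows_cons lefts_cons => /and3P[ab ok wf_s].
case: ifP ok => [_ _|_ /eqP]; last first.
  case: x ab => x1 [|y []] //= ab _ sub; rewrite mem_cat inE => /orP[|/eqP ->].
    by apply: IH.
  have := @above_lefts _ _ y v ab; rewrite inE eqxx (subseq1_mem sub) ?inE ?eqxx ?orbT //.
  by move=> /(_ isT isT) ltv /andP[_]; lia.
rewrite cats0 => /subseq_catP[[|u1 [|u2 s1]] [s2 [/= E sub1 sub2]]] c_s.
- by apply: IH => //; rewrite E.
- have := above_lows ab _ c_s; move/(_ u); case: E => -> _; rewrite -sub1seq sub1 => /(_ isT).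
  lia.
- have := above_lows ab _ c_s; move/(_ u); case: E => -> _ _.
  by rewrite (subseq1_mem sub1) ?inE ?eqxx // => /(_ isT); lia.
Qed.

(** With two letters in [lefts], [lefts_lows] applies; with fewer, the last two letters would form a
    descent in the increasing sequence [lows]. A new maximum placed after [lows] then creates no
    1324. *)
Lemma av132_lefts_lows s : wf s -> av132 (lefts s) -> av132 (lefts s ++ lows s).
Proof.
move=> wf_s av a b c /subseq_catP[s1 [s2 [E sub1 sub2]]] /andP[ac cb].
case: s1 E sub1 => [|x1 [|x2 [|x3 s1]]] /= E sub1.
- have : subseq [:: b; c] (lows s) by apply: subseq_trans sub2; rewrite -E subseq_cons.
  by move/(lows_incr wf_s); lia.
- by case: E => _ E; rewrite -E in sub2; have := lows_incr wf_s sub2; lia.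
- case: E sub1 => <- <- E sub1; apply: (lefts_lows wf_s sub1 (_ : c \in _)).
    by rewrite -sub1seq E.
  by rewrite ac.
- by case: E sub1 => <- <- <-; case: s1 => // _ sub1; apply: (av a b c); rewrite ?ac.
Qed.

Lemma filter_rem_low (T : Type) (p : pred T) i s : filter p (rem_low p i s) = filter p s.
Proof.
elim: s i => //= x s IH i; case px: (p x); first by rewrite /= px IH.
by case: i => [|i]; rewrite ?IH //= px.
Qed.

Lemma filterC_rem_low (T : Type) (p : pred T) i s :
  filter (predC p) (rem_low p i s) = drop i (filter (predC p) s).
Proof.
elim: s i => //= x s IH i; case px: (p x); first by rewrite /= px IH.
by case: i => [|i]; rewrite ?IH //= px.
Qed.

Lemma rem_low_subseq (T : eqType) (p : pred T) i s : subseq (rem_low p i s) s.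
Proof.
elim: s i => //= x s IH i; case px: (p x); first by rewrite eqxx.
case: i => [|i]; first by rewrite eqxx.
exact: subseq_trans (IH i) (subseq_cons _ _).
Qed.

Lemma cut_high_suffix (T : Type) (p : pred T) j s :
  take (size s - size (cut_high p j s)) s ++ cut_high p j s = s.
Proof.
have [t] : exists t, s = t ++ cut_high p j s.
  elim: s j => [|x s IH] [|j]; try by exists [::].
  by have [t E] := IH (if p x then j else j.+1); exists (x :: t); rewrite /= -E.
by move: (cut_high p j s) => u ->; rewrite size_cat addnK take_size_cat.
Qed.

Definition state := (seq item * seq nat)%type.

(** An open entry to the right of the new maximum [n] is closed: a later, larger entry to its right
    would complete a 213 with [n]. *)
Definition ins_low (n i : nat) (st : state) : state :=
  let s := rem_low fst i st.1 in
  ((false, [:: n]) :: s, lows s ++ n :: drop (size (lows s)) st.2).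

(** The new maximum stands to the right of the [j] highest components and fuses with them. An open
    entry c above the lowest of these is closed: some u < c of that component, then [n], c and a
    later larger entry would form 1324. *)
Definition ins_left (n j : nat) (st : state) : state :=
  let s := cut_high fst j st.1 in
  ((true, rcons (lefts (take (size st.1 - size s) st.1)) n) :: s, st.2).

Definition succ_state (n : nat) (st : state) : seq state :=
  [seq ins_low n i st | i <- iota 0 (count (predC fst) st.1).+1] ++
  [seq ins_left n j st | j <- iota 0 (count fst st.1).+1].

Fixpoint states (n : nat) : seq state :=
  if n is n'.+1 then flatten [seq succ_state n' st | st <- states n'] else [:: ([::], [::])].

Definition valid (n : nat) (st : state) : Prop :=
  [/\ perm_eq (lefts st.1 ++ st.2) (iota 0 n), av1324 (lefts st.1 ++ st.2),
      av132 (lefts st.1) /\ av213 st.2, prefix (lows st.1) st.2 & wf st.1].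

Lemma lefts_rem_low i s : lefts (rem_low fst i s) = lefts s.
Proof. by rewrite /lefts filter_rem_low. Qed.

Lemma prefix_lows_rem_low i s : prefix (lows (rem_low fst i s)) (lows s).
Proof.
rewrite /lows -[filter _ (rem_low _ _ _)]/(filter (predC fst) _) filterC_rem_low.
rewrite -[X in prefix _ (flatten (rev (map _ X)))](cat_take_drop i).
by rewrite map_cat rev_cat flatten_cat prefix_prefix.
Qed.

Lemma prefix_lows_cat s t : prefix (lows t) (lows (s ++ t)).
Proof. by rewrite /lows filter_cat map_cat rev_cat flatten_cat prefix_prefix. Qed.

Lemma prefix_drop (T : eqType) (s t : seq T) : prefix s t -> s ++ drop (size s) t = t.
Proof. by case/prefixP=> u ->; rewrite drop_size_cat. Qed.

Lemma perm_ins_max n (l1 l2 : seq nat) :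
  perm_eq (l1 ++ l2) (iota 0 n) -> perm_eq (l1 ++ n :: l2) (iota 0 n.+1).
Proof.
move=> pe; rewrite -cat_rcons -addn1 iotaD add0n -cats1 -catA perm_catCA /=.
by rewrite -cat1s perm_catC perm_cat.
Qed.

Section Valid.
Variables (n : nat) (st : state).
Hypothesis valid_st : valid n st.

Lemma valid_lt x : x \in lefts st.1 ++ st.2 -> x < n.
Proof.
by case: valid_st => pe _ _ _ _; rewrite (perm_mem pe) mem_iota add0n.
Qed.

Lemma item_lt x y : x \in st.1 -> y \in x.2 -> y < n.
Proof.
case: valid_st => _ _ _ /prefixP[t E] _ xs yx; apply: valid_lt.
rewrite mem_cat E mem_cat; case x1: x.1.
  by apply/orP; left; apply/flattenP; exists x.2; rewrite // map_f // mem_filter x1.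
apply/orP; right; apply/orP; left; apply/flattenP; exists x.2 => //.
by rewrite mem_rev map_f // mem_filter x1.
Qed.

Lemma wf_cons_max s b t : subseq s st.1 -> (forall y, y \in t -> y < n) ->
  (forall x y z, x \in s -> y \in x.2 -> z \in t -> y < z) ->
  (~~ b -> t = [::]) -> wf ((b, rcons t n) :: s).
Proof.
move=> sub lt_tn ab bt; have [_ _ _ _ wf_st] := valid_st.
rewrite wf_cons (wf_sub sub wf_st) /=; apply/and3P; split=> //; last first.
  by case: b bt => [_|->//]; case: t {lt_tn ab}.
apply/allP => x xs; apply/allrelP => z y /=; rewrite mem_rcons inE => /orP[/eqP ->|zt] yx.
  by apply: item_lt yx; apply: mem_subseq xs.
exact: (ab x).
Qed.

Lemma valid_ins_low i : valid n.+1 (ins_low n i st).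
Proof.
have [pe av [avl avr] pre wf_st] := valid_st.
set s := rem_low fst i st.1.
have pre_s : prefix (lows s) st.2 by apply: prefix_trans pre; apply: prefix_lows_rem_low.
have Es := prefix_drop pre_s.
have wf_s : wf s by apply: wf_sub wf_st; apply: rem_low_subseq.
have El : lefts s = lefts st.1 by apply: lefts_rem_low.
have lt_n x : x \in (lefts st.1 ++ lows s) ++ drop (size (lows s)) st.2 -> x < n.
  by rewrite -catA Es; apply: valid_lt.
rewrite /ins_low -/s; split; rewrite /= ?lefts_cons ?lows_cons /= ?El.
- by rewrite catA perm_ins_max // -catA Es.
- rewrite catA; apply: av1324_ins => //; first by rewrite -catA Es.
  by rewrite -El; apply: av132_lefts_lows; rewrite ?El.
- split=> //; apply: av213_ins; rewrite ?Es //.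
    by move=> x xs; apply: lt_n; rewrite -catA Es mem_cat xs orbT.
  by move=> x y; apply: lows_incr.
- by rewrite -[n :: drop _ _]cat1s catA prefix_prefix.
- by apply: (@wf_cons_max s false [::]) => //; apply: rem_low_subseq.
Qed.

Lemma valid_ins_left j : valid n.+1 (ins_left n j st).
Proof.
have [pe av [avl avr] pre wf_st] := valid_st.
have /= := cut_high_suffix fst j st.1; rewrite /ins_left.
set s := cut_high fst j st.1; set t := take _ _ => Est.
have El : lefts t ++ lefts s = lefts st.1 by rewrite -lefts_cat Est.
have lt_n x : x \in lefts t ++ lefts s ++ st.2 -> x < n.
  by rewrite catA El; apply: valid_lt.
have sub_s : subseq s st.1 by rewrite -Est suffix_subseq.
have pw : allrel above t s.
  by move: wf_st; rewrite /wf -Est pairwise_cat => /andP[/and3P[]].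
have gt x y : x \in lefts t -> y \in lefts s -> y < x.
  case/flattenP=> _ /mapP[u + ->]; rewrite mem_filter => /andP[_ ut] xu.
  case/flattenP=> _ /mapP[v + ->]; rewrite mem_filter => /andP[_ vs] yv.
  by move/allrelP: pw => /(_ u v ut vs)/allrelP; apply.
split; rewrite /= ?lefts_cons ?lows_cons /= ?cats0.
- by rewrite cat_rcons -catA perm_ins_max // catA El.
- rewrite cat_rcons -catA; apply: av1324_ins; rewrite ?catA ?El //.
    by move=> x; rewrite -El -catA; apply: lt_n.
  by apply: av132_sub avl; rewrite -El prefix_subseq.
- split=> //; rewrite cat_rcons; apply: av132_ins; rewrite ?El //.
  by move=> x xs; apply: lt_n; rewrite catA El mem_cat xs.
- by apply: prefix_trans pre; rewrite -Est prefix_lows_cat.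
- apply: wf_cons_max => // [y yt|x y z xs yx zt].
    by apply: lt_n; rewrite mem_cat yt.
  case/flattenP: zt => _ /mapP[u + ->]; rewrite mem_filter => /andP[_ ut] zu.
  by move/allrelP: pw => /(_ u x ut xs)/allrelP; apply.
Qed.
End Valid.

Lemma states_valid n st : st \in states n -> valid n st.
Proof.
elim: n st => [|n IH] st /=; first by rewrite inE => /eqP ->; split.
case/flatten_mapP=> st0 /IH valid0; rewrite mem_cat.
by case/orP=> /mapP[i _ ->]; [apply: valid_ins_low | apply: valid_ins_left].
Qed.

(** The available moves depend only on the marks of the items, so the states are exactly as many as
    the words. *)
Lemma map_fst_states n : [seq map fst st.1 | st <- states n] = words n.
Proof.
elim: n => [//|n IH]; rewrite [states n.+1]/= map_flatten -map_comp.
rewrite -[words n.+1]/(flatten (map succ_word (words n))) -IH -map_comp; congr flatten.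
apply: eq_map => -[s r].
rewrite -[LHS]/(map (fun st => map fst st.1) (succ_state n (s, r))).
rewrite -[RHS]/(succ_word (map fst s)) /succ_word /succ_state map_cat -!map_comp !count_map.
congr (_ ++ _); apply: eq_map => i /=.
  by rewrite -map_rem_low.
by rewrite -map_cut_high.
Qed.

(** * Distinct histories give distinct dominoes *)

Definition cells (st : state) : seq nat * seq nat := (lefts st.1, st.2).

Definition drop_max (n : nat) (k : seq nat * seq nat) : seq nat * seq nat :=
  (filter (predC1 n) k.1, filter (predC1 n) k.2).

Lemma filter_max n (l : seq nat) : n \notin l -> filter (predC1 n) l = l.
Proof.
move=> nl; apply/all_filterP/allP => x xl /=.
by apply: contra nl => /eqP <-.
Qed.

Lemma drop_max_cells n st st' : valid n st -> st' \in succ_state n st ->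
  drop_max n (cells st') = cells st.
Proof.
move=> v; have [pe _ _ pre _] := v.
have notin : n \notin lefts st.1 ++ st.2.
  by apply/negP => /(valid_lt v); rewrite ltnn.
have {notin} /andP[nl nr] : (n \notin lefts st.1) && (n \notin st.2).
  by rewrite -negb_or -mem_cat.
rewrite mem_cat => /orP[] /mapP[i _ ->]; rewrite /drop_max /cells /= ?lefts_cons /=.
  have pre_s : prefix (lows (rem_low fst i st.1)) st.2.
    by apply: prefix_trans pre; apply: prefix_lows_rem_low.
  rewrite filter_cat /= eqxx /= -filter_cat prefix_drop // lefts_rem_low.
  by rewrite !filter_max.
rewrite cat_rcons filter_cat /= eqxx /= -filter_cat -lefts_cat cut_high_suffix.
by rewrite !filter_max.
Qed.

Lemma size_lows s : wf s -> size (lows s) = count (predC fst) s.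
Proof.
elim: s => // x s IH; rewrite wf_cons lows_cons size_cat => /and3P[_ ok /IH ->].
by move: ok; rewrite /= addnC; case: x.1 => //= /eqP ->.
Qed.

Lemma lt_lefts_cut_high s j1 j2 : wf s -> j1 < j2 <= count fst s ->
  size (lefts (cut_high fst j2 s)) < size (lefts (cut_high fst j1 s)).
Proof.
elim: s j1 j2 => [|x s IH] j1 j2; first by rewrite /= leqn0 => _ /andP[/[swap]/eqP ->].
rewrite wf_cons => /and3P[_ ok wf_s]; case: j2 => // j2.
rewrite [count _ _]/= [cut_high _ j2.+1 _]/=; case: x ok => -[] t /= ok.
  rewrite add1n !ltnS => /andP[]; case: j1 => [_|j1 lt12] le2; last by apply: IH; rewrite ?lt12.
  rewrite lefts_cons size_cat /=; apply: (@leq_trans (size (lefts s)).+1).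
    rewrite ltnS; case: j2 le2 => [|j2] le2; first by rewrite cut_high0.
    by rewrite -[s in leqRHS](cut_high0 fst); apply: ltnW; apply: IH.
  by rewrite -addn1 addnC leq_add2r lt0n size_eq0.
rewrite add0n; case: j1 => [|j1] lt12; last by apply: IH.
rewrite lefts_cons /= -[s in ltnRHS](cut_high0 fst); exact: IH.
Qed.

(** The move is read off from [n]: its cell tells the kind, its index in the right cell gives [i],
    and the number of entries after it in the left cell gives [j], components being nonempty. *)
Lemma uniq_succ_state n st : valid n st -> uniq [seq cells st' | st' <- succ_state n st].
Proof.
move=> v; have [pe _ _ pre wf_st] := v.
have notin : n \notin lefts st.1 ++ st.2.
  by apply/negP => /(valid_lt v); rewrite ltnn.
have {notin} /andP[nl nr] : (n \notin lefts st.1) && (n \notin st.2).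
  by rewrite -negb_or -mem_cat.
rewrite map_cat cat_uniq -!map_comp; apply/and3P; split.
- rewrite map_inj_in_uniq ?iota_uniq // => i1 i2.
  rewrite !mem_iota !add0n !ltnS => /= le1 le2 [_ E].
  have E1 i : i <= count (predC fst) st.1 ->
    index n (lows (rem_low fst i st.1) ++ n :: drop (size (lows (rem_low fst i st.1))) st.2)
    = count (predC fst) st.1 - i.
    move=> le_i; rewrite index_cat /= eqxx addn0.
    have pre_s : prefix (lows (rem_low fst i st.1)) st.2.
      by apply: prefix_trans pre; apply: prefix_lows_rem_low.
    rewrite ifN; last first.
      by by case/prefixP: pre_s nr => u ->; rewrite mem_cat negb_or => /andP[].
    rewrite size_lows; last by apply: wf_sub wf_st; apply: rem_low_subseq.
    by rewrite -size_filter filterC_rem_low size_drop size_filter.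
  by have := E1 _ le1; rewrite E E1 //; lia.
- apply/hasPn => _ /mapP[j _ ->]; apply/negP => /mapP[i _ [E _]].
  have : n \in lefts (rem_low fst i st.1).
    by rewrite -[lefts (rem_low _ _ _)]E lefts_cons /= mem_cat mem_rcons inE eqxx.
  by rewrite lefts_rem_low (negPf nl).
- rewrite map_inj_in_uniq ?iota_uniq // => j1 j2.
  rewrite !mem_iota !add0n !ltnS => /= le1 le2 [E].
  have E1 j : size (lefts st.1) - index n (lefts (ins_left n j st).1)
      = size (lefts (cut_high fst j st.1)).
    have := cut_high_suffix fst j st.1; rewrite /ins_left lefts_cons /=.
    set s := cut_high _ _ _; set t := take _ _ => Est.
    rewrite -Est lefts_cat size_cat cat_rcons index_cat /= eqxx addn0 ifN ?addKn //.
    by apply: contra nl; rewrite -Est lefts_cat mem_cat => ->.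
  have E2 : size (lefts (cut_high fst j1 st.1)) = size (lefts (cut_high fst j2 st.1)).
    by rewrite -!E1 /= E.
  case: (ltngtP j1 j2) => // lt12.
    by have := lt_lefts_cut_high wf_st (_ : j1 < j2 <= _); rewrite lt12 E2 ltnn => /(_ le2).
  by have := lt_lefts_cut_high wf_st (_ : j2 < j1 <= _); rewrite lt12 E2 ltnn => /(_ le1).
Qed.

Lemma uniq_flatten_map (S T K K' : eqType) (h : S -> K) (g : K' -> K) (k : T -> K')
    (F : S -> seq T) (l : seq S) :
  {in l, forall s, uniq (map k (F s))} ->
  {in l, forall s t, t \in F s -> g (k t) = h s} ->
  uniq (map h l) -> uniq (map k (flatten (map F l))).
Proof.
elim: l => //= s l IH uF gk /andP[nhs uh]; rewrite map_cat cat_uniq.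
rewrite uF ?mem_head //= IH //; first last.
- by move=> s' ls'; apply: gk; rewrite inE ls' orbT.
- by move=> s' ls'; apply: uF; rewrite inE ls' orbT.
rewrite andbT; apply: contra nhs => /hasP[_ /mapP[t /flatten_mapP[s' ls' ts'] ->]].
case/mapP=> t1 /(gk _ (mem_head _ _)) <- <-.
by rewrite (gk s') ?map_f // inE ls' orbT.
Qed.

(** Removing the largest entry recovers the cells of the predecessor, so the history can be undone
    step by step. *)
Lemma uniq_states n : uniq [seq cells st | st <- states n].
Proof.
elim: n => //= n IH; apply: (uniq_flatten_map (h := cells) (g := drop_max n)) => //.
  by move=> st /states_valid; apply: uniq_succ_state.
by move=> st /states_valid v st'; apply: drop_max_cells.
Qed.

Definition at_least (k : nat) (P : seq nat -> Prop) : Prop :=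
  exists ls : seq (seq nat), [/\ uniq ls, k <= size ls & {in ls, forall l, P l}].

Lemma at_least_map (f : seq nat -> seq nat) k (P Q : seq nat -> Prop) :
  (forall l, P l -> Q (f l)) -> (forall l l', P l -> P l' -> f l = f l' -> l = l') ->
  at_least k P -> at_least k Q.
Proof.
move=> PQ f_inj [ls [uls le_k Pls]]; exists (map f ls); rewrite size_map; split=> //.
  by rewrite map_inj_in_uniq // => l l' /Pls Pl /Pls Pl'; apply: f_inj.
by move=> _ /mapP[l /Pls/PQ Ql ->].
Qed.

(* A horizontal domino: the left cell consists of the first [b] positions. *)
Definition domino (b t : nat) (l : seq nat) : Prop :=
  [/\ perm_eq l (iota 0 (b + t)), av1324 l, av132 (take b l) & av213 (drop b l)].

(** Pigeonhole on the size of the left cell, which takes at most n + 1 values. *)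
Lemma many_dominoes n : exists b t k,
  [/\ b + t = n, size (words n) <= n.+1 * k & at_least k (domino b t)].
Proof.
pose ls b := [seq cells st | st <- states n & size (lefts st.1) == b].
have le_n st : st \in states n -> size (lefts st.1) < n.+1.
  move=> /states_valid[/perm_size + _ _ _ _].
  by rewrite size_cat size_iota ltnS => <-; apply: leq_addr.
have [b le_b] : exists b : 'I_n.+1, size (words n) <= n.+1 * size (ls b).
  exists [arg max_(b > ord0 | true) size (ls (val b))].
  case: arg_maxnP => // b _ max_b; apply: leq_trans (_ : \sum_(i < n.+1) size (ls i) <= _).
    rewrite -map_fst_states size_map -sum1_size.
    under [leqRHS]eq_bigr => i _ do rewrite size_map size_filter -sum1_count.
    rewrite (exchange_big_dep xpredT) //= big_seq [leqRHS]big_seq.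
    apply: leq_sum => st st_n.
    by rewrite (bigD1 (Ordinal (le_n st st_n))) /=.
  by rewrite -[X in X * _]card_ord -sum_nat_const; apply: leq_sum => i _; apply: max_b.
exists b, (n - b), (size (ls b)); have le_bn : b <= n by rewrite -ltnS.
rewrite subnKC //; split=> //.
exists [seq k.1 ++ k.2 | k <- ls b]; rewrite size_map; split=> //.
  rewrite map_inj_in_uniq.
    apply: subseq_uniq (uniq_states n); apply: map_subseq; apply: filter_subseq.
  move=> _ _ /mapP[st + ->] /mapP[st' + ->]; rewrite !mem_filter /cells /=.
  move=> /andP[/eqP sz _] /andP[/eqP sz' _] /eqP.
  by rewrite eqseq_cat ?sz ?sz' // => /andP[/eqP-> /eqP->].
move=> _ /mapP[_ /mapP[st + ->] ->]; rewrite mem_filter /cells /= => /andP[/eqP sz].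
move=> /states_valid[pe av [avl avr] _ _]; rewrite /domino subnKC //.
by rewrite take_size_cat // drop_size_cat.
Qed.

(** * Gluing a domino to a permutation *)

Fixpoint bin_words (n k : nat) : seq bitseq :=
  match n with
  | 0 => if k is 0 then [:: [::]] else [::]
  | n'.+1 => map (cons false) (bin_words n' k) ++
             (if k is k'.+1 then map (cons true) (bin_words n' k') else [::])
  end.

Lemma size_bin_words n k : size (bin_words n k) = 'C(n, k).
Proof.
elim: n k => [|n IH] [|k] //=; rewrite size_cat !size_map !IH; first by rewrite !bin0.
by rewrite binS.
Qed.

Lemma uniq_bin_words n k : uniq (bin_words n k).
Proof.
have cons_inj b : injective (cons b : bitseq -> bitseq) by move=> ? ? [].
elim: n k => [|n IH] [|k] //=; rewrite ?cats0 ?cat_uniq ?map_inj_uniq ?IH //= andbT.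
by apply/hasPn => _ /mapP[w _ ->]; apply/negP => /mapP[].
Qed.

Lemma mem_bin_words n k w : w \in bin_words n k -> count id w = k /\ size w = n.
Proof.
elim: n k w => [|n IH] [|k] w //=; first by rewrite inE => /eqP->.
  by rewrite cats0 => /mapP[v /IH[cv sv] ->]; rewrite /= cv sv.
by rewrite mem_cat => /orP[] /mapP[v /IH[cv sv] ->]; rewrite /= cv sv.
Qed.

Fixpoint shuffle (w : bitseq) (s1 s2 : seq nat) : seq nat :=
  match w, s1, s2 with
  | true :: w', x :: s1', _ => x :: shuffle w' s1' s2
  | false :: w', _, y :: s2' => y :: shuffle w' s1 s2'
  | _, _, _ => s1 ++ s2
  end.

Lemma shuffle_true w x s1 s2 : shuffle (true :: w) (x :: s1) s2 = x :: shuffle w s1 s2.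
Proof. by []. Qed.

Lemma shuffle_false w s1 y s2 : shuffle (false :: w) s1 (y :: s2) = y :: shuffle w s1 s2.
Proof. by case: s1. Qed.

Lemma shuffle_nil w s1 s2 : (s1 == [::]) || (s2 == [::]) ->
  shuffle w s1 s2 = s1 ++ s2.
Proof.
elim: w s1 s2 => [|[] w IH] [|x s1] [|y s2] //= _; rewrite IH ?orbT //.
Qed.

Lemma perm_shuffle w s1 s2 : perm_eq (shuffle w s1 s2) (s1 ++ s2).
Proof.
elim: w s1 s2 => [|[] w IH] s1 s2 //.
  case: s1 => [|x s1]; first by rewrite shuffle_nil.
  by rewrite shuffle_true perm_cons.
case: s2 => [|y s2]; first by rewrite shuffle_nil ?eqxx ?orbT.
by rewrite shuffle_false perm_sym -[y :: s2]cat1s perm_catCA /= perm_cons perm_sym.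
Qed.

Section ShuffleFilter.
Variables (p : pred nat).

Lemma filter_shuffle w s1 s2 : all p s1 -> all (predC p) s2 ->
  filter p (shuffle w s1 s2) = s1 /\ filter (predC p) (shuffle w s1 s2) = s2.
Proof.
have base t1 t2 : all p t1 -> all (predC p) t2 ->
    filter p (t1 ++ t2) = t1 /\ filter (predC p) (t1 ++ t2) = t2.
  move=> p1 p2; rewrite !filter_cat (all_filterP p1) (all_filterP p2).
  have /all_filterP e1 : all (predC (predC p)) t1 by apply: sub_all p1 => x /= ->.
  have f1 : filter (predC p) t1 = [::].
    by apply/eqP; rewrite -(negbK (_ == _)) -has_filter has_predC p1.
  have f2 : filter p t2 = [::].
    by apply/eqP; rewrite -(negbK (_ == _)) -has_filter -all_predC p2.
  by rewrite f1 f2 cats0.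
elim: w s1 s2 => [|[] w IH] s1 s2 p1 p2; first exact: base.
  case: s1 p1 => [|x s1] p1; first by rewrite shuffle_nil //; apply: base.
  by case/andP: p1 => px p1 /=; rewrite px /=; have [-> ->] := IH s1 s2 p1 p2.
case: s2 p2 => [|y s2] p2; first by rewrite shuffle_nil ?orbT //; apply: base.
case/andP: p2 => py p2; rewrite shuffle_false /=; have [E1 E2] := IH s1 s2 p1 p2.
by rewrite (negPf py) /= E1 E2.
Qed.

Lemma map_shuffle w s1 s2 : all p s1 -> all (predC p) s2 ->
  count id w = size s1 -> size w = size s1 + size s2 -> map p (shuffle w s1 s2) = w.
Proof.
elim: w s1 s2 => [|[] w IH] s1 s2; first by case: s1; case: s2.
  case: s1 => //= x s1 /andP[-> p1] p2 [c1] [c2]; rewrite IH //; lia.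
case: s2 => [|y s2] p1.
  by move=> _ /= <-; rewrite addn0 => E; have := count_size id w; lia.
case/andP=> py p2 c1 c2; have E : map p (shuffle w s1 s2) = w.
  by apply: IH => //; move: c1 c2 => /=; lia.
by rewrite shuffle_false /= (negPf py) E.
Qed.
End ShuffleFilter.

(* The word [w] lists, from the top down, the entries of two interleaved sets of
   values, [true] marking the entries of the decreasing cell. *)
Fixpoint link_values (m : nat) (w : bitseq) : seq nat :=
  match w with
  | [::] => [::]
  | true :: w' => (m + size w') :: link_values m w'
  | false :: w' => link_values m w'
  end.

(** The letters [false] of [w'] stand for the values smaller than [count negb w'], so [v] lies above
    the current [true] exactly when it is at least this count. Values not counted by [w] at all
    clear the whole decreasing cell. *)
Fixpoint below (w : bitseq) (v : nat) : nat :=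
  if w is x :: w' then (x && (count negb w' <= v)) + below w' v else 0.

Definition raise (m : nat) (w : bitseq) (v : nat) : nat := m + v + below w v.

Lemma size_link_values m w : size (link_values m w) = count id w.
Proof. by elim: w => [|[] w IH] //=; rewrite IH. Qed.

Lemma link_valuesP m w x : x \in link_values m w ->
  exists u v, w = u ++ true :: v /\ x = m + size v.
Proof.
elim: w => [|[] w IH] //=; last by move=> /IH[u [v [-> ->]]]; exists (false :: u), v.
rewrite inE => /orP[/eqP ->|/IH[u [v [-> ->]]]]; first by exists [::], w.
by exists (true :: u), v.
Qed.

Lemma link_values_decr m w x y : subseq [:: x; y] (link_values m w) -> y < x.
Proof.
elim: w => [|[] w IH] //; rewrite [link_values _ _]/= [subseq _ _]/=.
case: eqP => [-> | _]; last exact: IH.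
by rewrite sub1seq => /link_valuesP[u [v [-> ->]]]; rewrite size_cat /=; lia.
Qed.

Lemma uniq_link_values m w : uniq (link_values m w).
Proof.
elim: w => [|[] w IH] //=; rewrite IH andbT; apply/negP => /link_valuesP[u [v [->]]].
by rewrite size_cat /=; lia.
Qed.

Lemma link_values_inj m w1 w2 : size w1 = size w2 ->
  link_values m w1 = link_values m w2 -> w1 = w2.
Proof.
have aux w v : size w = size v -> link_values m (true :: w) <> link_values m (false :: v).
  move=> sz /= E; have : m + size w \in link_values m v by rewrite -E mem_head.
  by case/link_valuesP=> [u [v' [Ev]]]; rewrite sz Ev size_cat /=; lia.
elim: w1 w2 => [|b1 w1 IH] [|b2 w2] // [sz]; case: b1; case: b2.
- by case=> _ /(IH _ sz) ->.
- by move/(aux _ _ sz).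
- by move/esym/(aux _ _ (esym sz)).
- by move/(IH _ sz) ->.
Qed.

Lemma below_le w v : below w v <= count id w.
Proof. by elim: w => //= -[] w IH //=; lia. Qed.

Lemma below_mono w v v' : v <= v' -> below w v <= below w v'.
Proof. by move=> le_v; elim: w => //= x w IH; case: x => //=; lia. Qed.

Lemma raise_lt m w v v' : (raise m w v < raise m w v') = (v < v').
Proof.
by rewrite /raise; case: (ltnP v v') => le_v; [have := below_mono w (ltnW le_v)
  | have := below_mono w le_v]; lia.
Qed.

Lemma raise_inj m w : injective (raise m w).
Proof.
by move=> v v' E; case: (ltngtP v v') => //; rewrite -(raise_lt m w) E ltnn.
Qed.

Lemma below_cat u w v : below (u ++ w) v <= below w v + count id u * (count negb w <= v).
Proof.
elim: u => [|x u IH] /=; first by lia.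
by rewrite count_cat; case: x => /=; move: IH; case: (leqP (count negb w) v) => /=; lia.
Qed.

Lemma below_cat_ge u w v : below w v <= below (u ++ w) v.
Proof. by elim: u => //= x u IH; lia. Qed.

Lemma raise_link_values m u v x : let w := u ++ true :: v in
  (raise m w x < m + size v) = (x < count negb v) /\ raise m w x != m + size v.
Proof.
rewrite /= /raise; have sz : size v = count negb v + count id v.
  by rewrite -(count_predC negb v); congr (_ + _); apply: eq_count => -[].
case: (ltnP x (count negb v)) => lt_x.
  have le_x : (count negb v <= x) = false by lia.
  have := below_cat u (true :: v) x; rewrite /= !add0n le_x /= muln0 addn0.
  by have := below_le v x; lia.
have : count negb v <= x -> below v x = count id v.
  elim: v {sz lt_x} => //= b v IH le_x; rewrite IH; last by case: b le_x => /=; lia.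
  by case: b le_x => /= le_x; rewrite ?le_x //.
move=> /(_ lt_x) E; have := below_cat_ge u (true :: v) x; rewrite /= lt_x E; lia.
Qed.

(** The free end of a chain: a bottom cell is delimited by value, the last cell of [right_cell] by
    position. *)
Definition lower_cell (n b : nat) (l : seq nat) : Prop :=
  [/\ perm_eq l (iota 0 n), av1324 l, av132 [seq x <- l | x < b] & b <= n].

Definition right_cell (n t : nat) (l : seq nat) : Prop :=
  [/\ perm_eq l (iota 0 n), av1324 l, av213 (drop (n - t) l) & t <= n].

(* [P] is above and to the left of [Q]; the decreasing cell shares its values with
   the entries of [P] smaller than [b] and its positions with the first [b]
   entries of [Q]. *)
Definition glue (b : nat) (P Q : seq nat) (w1 w2 : bitseq) : seq nat :=
  map (raise (size Q) w1) P ++ shuffle w2 (link_values (size Q) w1) (take b Q) ++ drop b Q.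

Lemma subseq_mapP (T U : eqType) (f : T -> U) s l : subseq s (map f l) ->
  exists2 s', s = map f s' & subseq s' l.
Proof.
case/subseqP=> m sz_m ->; exists (mask m l); first by rewrite map_mask.
exact: mask_subseq.
Qed.

Lemma perm_iotaP n l : uniq l -> size l = n -> (forall x, x \in l -> x < n) ->
  perm_eq l (iota 0 n).
Proof.
move=> ul sz lt_n; apply: uniq_perm => //; first exact: iota_uniq.
have sub : {subset l <= iota 0 n} by move=> x /lt_n; rewrite mem_iota.
by have [] := uniq_min_size ul sub; rewrite ?size_iota ?sz.
Qed.

Section Glue.
Variables (n b t r : nat) (P Q : seq nat) (w1 w2 : bitseq).
Hypotheses (cellP : lower_cell n b P) (cellQ : domino b t Q).
Hypotheses (w1_r : w1 \in bin_words (b + r) r) (w2_r : w2 \in bin_words (b + r) r).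

Let m := size Q.
Let R := link_values m w1.
Let T := map (raise m w1) P.

Lemma size_Q : m = b + t. Proof. by case: cellQ => /perm_size; rewrite size_iota. Qed.
Lemma size_P : size P = n. Proof. by case: cellP => /perm_size; rewrite size_iota. Qed.
Lemma size_R : size R = r.
Proof. by rewrite size_link_values; case: (mem_bin_words w1_r). Qed.

Lemma Q_lt x : x \in Q -> x < m.
Proof. by case: cellQ => pe _ _ _; rewrite (perm_mem pe) mem_iota size_Q. Qed.

Lemma R_ge x : x \in R -> m <= x.
Proof. by case/link_valuesP=> [u [v [_ ->]]]; apply: leq_addr. Qed.

Lemma T_ge x : x \in T -> m <= x.
Proof. by case/mapP=> v _ ->; rewrite /raise -addnA leq_addr. Qed.

Let high := fun x => m <= x.

Lemma all_R : all high R. Proof. by apply/allP => x /R_ge. Qed.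
Lemma all_T : all high T. Proof. by apply/allP => x /T_ge. Qed.
Lemma all_Q (l : seq nat) : {subset l <= Q} -> all (predC high) l.
Proof. by move=> sub; apply/allP => x /sub/Q_lt; rewrite /= /high -ltnNge. Qed.
Lemma all_takeQ : all (predC high) (take b Q).
Proof. by apply: all_Q => x; apply: mem_take. Qed.
Lemma all_dropQ : all (predC high) (drop b Q).
Proof. by apply: all_Q => x; apply: mem_drop. Qed.

Lemma filter_none (p : pred nat) l : all (predC p) l -> filter p l = [::].
Proof. by rewrite all_predC has_filter negbK => /eqP. Qed.

Let S := shuffle w2 R (take b Q).

Lemma filter_S : filter high S = R /\ filter (predC high) S = take b Q.
Proof. exact: filter_shuffle all_R all_takeQ. Qed.

Lemma filter_high_glue : filter high (glue b P Q w1 w2) = T ++ R.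
Proof.
rewrite /glue -/m -/R -/T -/S !filter_cat (filter_none all_dropQ) cats0.
by rewrite (all_filterP all_T) filter_S.1.
Qed.

Lemma filter_low_glue : filter (predC high) (glue b P Q w1 w2) = Q.
Proof.
rewrite /glue -/m -/R -/T -/S !filter_cat (all_filterP all_dropQ) filter_S.2.
rewrite filter_none ?cat_take_drop //.
by apply: sub_all all_T => x /= ->.
Qed.

(** [R] is decreasing, so it can contribute only the 4 of a 1324 that is not inside [T]. The other
    three letters then come from entries of [P] smaller than [b], which avoid 132. *)
Lemma av1324_upper : av1324 (T ++ R).
Proof.
have [pe av avP le_bn] := cellP.
move=> x1 x2 x3 x4 /subseq_catP[s1 [s2 [E sub1 sub2]]] /and3P[lt13 lt32 lt24].
have lt34 : x3 < x4 by apply: ltn_trans lt24.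
case: (lastP s2) E sub2 => [|s2' y]; rewrite ?cats0.
  move=> E _; move: sub1; rewrite -E => /subseq_mapP[s' + sub'].
  case: s' sub' => [|y1 [|y2 [|y3 [|y4 []]]]] //= sub' [E1 E2 E3 E4].
  by move: lt13 lt32 lt24; rewrite E1 E2 E3 E4 !raise_lt => *; apply: av sub' _; apply/and3P.
case: (lastP s2') => [|s3 z] E sub2; last first.
  have [Ez Ey] : x3 = z /\ x4 = y.
    move: (congr1 rev E); rewrite rev_cat !rev_rcons.
    by rewrite -[[:: x1; x2; x3; x4]]/(rcons (rcons [:: x1; x2] x3) x4) !rev_rcons /= => -[].
  have : subseq [:: z; y] R.
    apply: subseq_trans sub2; rewrite -cats1 -cats1 -catA; exact: suffix_subseq.
  by move=> /link_values_decr; rewrite -Ez -Ey; lia.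
have [Es Ey] : s1 = [:: x1; x2; x3] /\ x4 = y.
  move: E; rewrite -[[:: x1; x2; x3; x4]]/([:: x1; x2; x3] ++ [:: x4]) /= => /eqP.
  by rewrite -[_ :: _]/([:: x1; x2; x3] ++ [:: x4]) cats1 cats1 eqseq_rcons => /andP[/eqP <- /eqP].
move: sub2; rewrite sub1seq -Ey => /link_valuesP[u [v [Ew Ex4]]].
move: sub1; rewrite Es => /subseq_mapP[s' + sub'].
case: s' sub' => [|y1 [|y2 [|y3 []]]] //= sub' [E1 E2 E3].
(* An entry of [R] exceeds only raised values below [count negb v], and [w1] has exactly [b] letters
   [false]. *)
have lt_b y' : raise m w1 y' < x4 -> y' < b.
  have [lt_y _] := raise_link_values m u v y'; rewrite Ew Ex4 lt_y => /leq_trans; apply.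
  have [c1 s1'] := mem_bin_words w1_r.
  have : count negb w1 = b.
    by have := count_predC id w1; rewrite c1 s1' addnC => /addIn.
  by rewrite Ew count_cat /=; lia.
apply: (avP y1 y2 y3); last first.
  by move: lt13 lt32; rewrite E1 E2 E3 !raise_lt => -> ->.
rewrite subseq_filter sub' andbT /= !lt_b //; first by rewrite -E3.
  by rewrite -E2.
by rewrite -E1; lia.
Qed.

(** An occurrence with its 4 in [Q] lies in [Q], and one with its 1 above [Q] lies in [T ++ R].
    Otherwise the low 1 is to the right of [T] and the high 4 to the left of [drop b Q], so all lies
    in [S]: a low 3 gives a 132 in [take b Q], a high 3 gives an ascent in [R]. *)
Lemma av1324_glue : av1324 (glue b P Q w1 w2).
Proof.
have [pe av avl avr] := cellQ.
move=> x1 x2 x3 x4 sub /and3P[lt13 lt32 lt24].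
case: (ltnP x4 m) => [lt4|le4].
  have : subseq [:: x1; x2; x3; x4] (filter (predC high) (glue b P Q w1 w2)).
    by rewrite subseq_filter sub andbT /= /high; lia.
  by rewrite filter_low_glue => /av; apply; apply/and3P.
case: (leqP m x1) => [le1|lt1].
  have : subseq [:: x1; x2; x3; x4] (filter high (glue b P Q w1 w2)).
    by rewrite subseq_filter sub andbT /= /high; lia.
  by rewrite filter_high_glue => /av1324_upper; apply; apply/and3P.
case/subseq_catP: sub => s1 [s2 [E sub1 sub2]].
case: s1 E sub1 => [|y s1] E sub1; last first.
  have := @T_ge y; rewrite (subseq1_mem sub1) ?mem_head // => /(_ isT).
  by case: E => <- _; rewrite leqNgt lt1.
rewrite /= in E; rewrite -{s2}E in sub2.
case/subseq_catP: sub2 => s1' [s2 [E sub1' sub2]].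
case: (lastP s2) E sub2 => [|s3 y] E sub2; last first.
  have Ey : x4 = y.
    move: (congr1 (last 0) E); rewrite last_cat last_rcons //.
  have := subseq1_mem sub2 (_ : y \in _); rewrite mem_rcons mem_head => /(_ isT).
  by move/mem_drop/Q_lt; rewrite -Ey ltnNge le4.
rewrite cats0 in E; rewrite -{s1'}E -/m -/R -/S in sub1'.
have [SR SQ] := filter_S.
case: (ltnP x2 m) => [lt2|le2].
  have : subseq [:: x1; x2; x3] (filter (predC high) S).
    rewrite subseq_filter (subseq_trans _ sub1') ?andbT; first by rewrite /= /high; lia.
    exact: (mask_subseq [:: true; true; true] [:: x1; x2; x3; x4]).
  by rewrite SQ => /avl; apply; rewrite lt13.
have : subseq [:: x2; x4] (filter high S).
  rewrite subseq_filter [all _ _]/= /high le2 le4; apply: subseq_trans sub1'.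
  exact: (mask_subseq [:: false; true; false; true] [:: x1; x2; x3; x4]).
by rewrite SR => /link_values_decr; lia.
Qed.

Lemma glue_right_cell : right_cell (n + r + (b + t)) t (glue b P Q w1 w2).
Proof.
have [peP avP avlP le_bn] := cellP; have [peQ avQ avl avr] := cellQ.
have sz_take : size (take b Q) = b by rewrite size_takel // -/m size_Q leq_addr.
have sz_S : size S = r + b by rewrite (perm_size (perm_shuffle _ _ _)) size_cat size_R sz_take.
have sz_T : size T = n by rewrite size_map size_P.
split; last by lia.
- apply: perm_iotaP.
  + have uT : uniq T.
      rewrite map_inj_uniq; first by rewrite (perm_uniq peP) iota_uniq.
      exact: raise_inj.
    have uQ : uniq Q by rewrite (perm_uniq peQ) iota_uniq.
    have pe : perm_eq (glue b P Q w1 w2) ((T ++ R) ++ Q).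
      rewrite -{2}[Q](cat_take_drop b) /glue -/m -/R -/T -!catA perm_cat2l catA.
      by rewrite perm_cat2r perm_shuffle.
    rewrite (perm_uniq pe) !cat_uniq uT uQ uniq_link_values /= andbT.
    apply/andP; split.
      apply/hasPn => _ /link_valuesP[u [v [Ew ->]]]; apply/negP => /mapP[x _ Ex].
      by have [_] := raise_link_values m u v x; rewrite -Ew Ex eqxx.
    rewrite andbT; apply/hasPn => x /Q_lt; rewrite ltnNge mem_cat; apply: contra => /orP[].
      exact: T_ge.
    exact: R_ge.
  + rewrite !size_cat -/m -/T -/R -/S sz_T sz_S size_drop -/m size_Q; lia.
  + move=> x; rewrite !mem_cat -/m -/T -/R => /or3P[/mapP[y Py ->]| |/mem_drop/Q_lt].
    * have : y < n by move: Py; rewrite (perm_mem peP) mem_iota.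
      have := below_le w1 y; have [-> _] := mem_bin_words w1_r.
      by rewrite /raise size_Q; lia.
    * rewrite (perm_mem (perm_shuffle _ _ _)) mem_cat => /orP[|/mem_take/Q_lt].
        case/link_valuesP=> [u [v [Ew ->]]]; have [_] := mem_bin_words w1_r.
        by rewrite Ew size_cat /= size_Q; lia.
      by rewrite size_Q; lia.
    * by rewrite size_Q; lia.
- exact: av1324_glue.
have -> : n + r + (b + t) - t = size (T ++ S).
  by rewrite size_cat sz_T sz_S; lia.
by rewrite /glue -/m -/T -/R -/S catA drop_size_cat.
Qed.

End Glue.

(** Cutting the values at [size Q] separates [Q] from [T ++ R]; [R] determines [w1], hence [P], and
    the positions of the high values in the shuffle spell [w2]. *)
Lemma glue_inj n b t r P Q w1 w2 P' Q' w1' w2' :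
  lower_cell n b P -> domino b t Q ->
  w1 \in bin_words (b + r) r -> w2 \in bin_words (b + r) r ->
  lower_cell n b P' -> domino b t Q' ->
  w1' \in bin_words (b + r) r -> w2' \in bin_words (b + r) r ->
  glue b P Q w1 w2 = glue b P' Q' w1' w2' ->
  [/\ P = P', Q = Q', w1 = w1' & w2 = w2'].
Proof.
move=> cP cQ hw1 hw2 cP' cQ' hw1' hw2' E.
have szQ := size_Q cQ; have szQ' := size_Q cQ'.
have [c1 s1] := mem_bin_words hw1; have [c1' s1'] := mem_bin_words hw1'.
have [c2 s2] := mem_bin_words hw2; have [c2' s2'] := mem_bin_words hw2'.
have EQ : Q = Q'.
  by rewrite -(filter_low_glue P w1 w2 cQ) -(filter_low_glue P' w1' w2' cQ') E szQ szQ'.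
have := filter_high_glue P w1 w2 cQ; rewrite E -EQ (@filter_high_glue b t) //.
move/eqP; rewrite eqseq_cat ?size_map ?(size_P cP) ?(size_P cP') //.
case/andP=> /eqP ET /eqP ER.
have Ew1 : w1 = w1' by apply: (@link_values_inj (size Q)); rewrite ?s1 ?s1'.
have EP : P = P'.
  by move: ET; rewrite Ew1 => /inj_map ->; last exact: raise_inj.
split=> //; move: E; rewrite /glue -EP -EQ -Ew1 => /eqP.
rewrite eqseq_cat // eqxx /= eqseq_cat; last first.
  by rewrite !(perm_size (perm_shuffle _ _ _)).
case/andP=> /eqP ES _.
have sz2 w : count id w = r -> size w = b + r ->
    count id w = size (link_values (size Q) w1) /\
    size w = size (link_values (size Q) w1) + size (take b Q).
  by move=> -> ->; rewrite size_link_values c1 size_takel ?szQ ?leq_addr // addnC.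
have [d1 d2] := sz2 _ c2 s2; have [d1' d2'] := sz2 _ c2' s2'.
rewrite -(map_shuffle (all_R Q w1) (all_takeQ cQ) d1 d2).
by rewrite -(map_shuffle (all_R Q w1) (all_takeQ cQ) d1' d2') ES.
Qed.

Lemma at_least_glue n b t r j k : at_least j (lower_cell n b) -> at_least k (domino b t) ->
  at_least (j * k * 'C(b + r, r) ^ 2) (right_cell (n + r + (b + t)) t).
Proof.
case=> Ps [uP le_j cP] [Qs [uQ le_k cQ]].
pose ws := bin_words (b + r) r.
pose A := [seq (P, Q) | P <- Ps, Q <- Qs]; pose W := [seq (u, v) | u <- ws, v <- ws].
have pair_inj (T U : eqType) (s : seq T) (s' : seq U) : uniq s -> uniq s' ->
    uniq [seq (x, y) | x <- s, y <- s'].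
  by move=> us us'; apply: allpairs_uniq => // -[x y] [x' y'].
have memA p : p \in A -> lower_cell n b p.1 /\ domino b t p.2.
  by case/allpairsP=> -[P Q] [/cP ? /cQ ? ->].
have memW p : p \in W -> p.1 \in ws /\ p.2 \in ws.
  by case/allpairsP=> -[u v] [? ? ->].
exists [seq glue b p.1 p.2 q.1 q.2 | p <- A, q <- W]; split.
- apply: allpairs_uniq; [exact: pair_inj | by apply: pair_inj; exact: uniq_bin_words | ].
  move=> x y /allpairsP[[[P Q] [u v]] [/memA[/= cP1 cQ1] /memW[/= hu hv] ->]].
  move=> /allpairsP[[[P' Q'] [u' v']] [/memA[/= cP2 cQ2] /memW[/= hu' hv'] ->]] /= E.
  by have [-> -> -> ->] := glue_inj cP1 cQ1 hu hv cP2 cQ2 hu' hv' E.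
- by rewrite !size_allpairs size_bin_words -mulnn !leq_mul.
move=> _ /allpairsP[[p q] [/memA[cP1 cQ1] /memW[hu hv] ->]].
exact: glue_right_cell.
Qed.

(** * Symmetries *)

Definition revcomp (n : nat) (l : seq nat) : seq nat := rev [seq n - v.+1 | v <- l].
Definition inv_seq (n : nat) (l : seq nat) : seq nat := [seq index v l | v <- iota 0 n].

Section RevComp.
Variable n : nat.

Lemma perm_revcomp l : perm_eq l (iota 0 n) -> perm_eq (revcomp n l) (iota 0 n).
Proof.
move=> pe; have mem x : x \in l -> x < n by rewrite (perm_mem pe) mem_iota.
apply: perm_iotaP.
- rewrite rev_uniq map_inj_in_uniq ?(perm_uniq pe) ?iota_uniq // => x y /mem ? /mem ?; lia.
- by rewrite size_rev size_map (perm_size pe) size_iota.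
by move=> x; rewrite mem_rev => /mapP[y /mem lt_y ->]; lia.
Qed.

Lemma revcomp_inj l l' : perm_eq l (iota 0 n) -> perm_eq l' (iota 0 n) ->
  revcomp n l = revcomp n l' -> l = l'.
Proof.
have K l0 : perm_eq l0 (iota 0 n) -> revcomp n (revcomp n l0) = l0.
  move=> pe; rewrite /revcomp map_rev revK -map_comp -[RHS]map_id.
  by apply/eq_in_map => x; rewrite (perm_mem pe) mem_iota /=; lia.
by move=> /K {2}<- /K {2}<- ->.
Qed.

Lemma subseq_revcomp s l : subseq s (revcomp n l) ->
  exists2 s', s = revcomp n s' & subseq s' l.
Proof.
rewrite /revcomp -map_rev => /subseq_mapP[s' -> sub]; exists (rev s').
  by rewrite -map_rev revK.
by rewrite -subseq_rev revK.
Qed.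

Lemma av1324_revcomp l : (forall x, x \in l -> x < n) -> av1324 l -> av1324 (revcomp n l).
Proof.
move=> lt_n av a b c d /subseq_revcomp[s E sub].
have [x1 [x2 [x3 [x4 Es]]]] : exists x1 x2 x3 x4, s = [:: x1; x2; x3; x4].
  have := congr1 size E; rewrite size_rev size_map.
  by case: s {E sub} => [|x1 [|x2 [|x3 [|x4 []]]]] // _; exists x1, x2, x3, x4.
subst s; case: E => -> -> -> ->.
have h x : x \in [:: x1; x2; x3; x4] -> x < n by move/(subseq1_mem sub)/lt_n.
have [h1 [h2 [h3 h4]]] : x1 < n /\ x2 < n /\ x3 < n /\ x4 < n.
  by rewrite !h // !inE eqxx ?orbT.
by move=> /and3P[? ? ?]; apply: (av _ _ _ _ sub); apply/and3P; split; lia.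
Qed.

Lemma av132_revcomp l : (forall x, x \in l -> x < n) -> av213 l -> av132 (revcomp n l).
Proof.
move=> lt_n av a b c /subseq_revcomp[s E sub].
have [x1 [x2 [x3 Es]]] : exists x1 x2 x3, s = [:: x1; x2; x3].
  have := congr1 size E; rewrite size_rev size_map.
  by case: s {E sub} => [|x1 [|x2 [|x3 []]]] // _; exists x1, x2, x3.
subst s; case: E => -> -> ->.
have h x : x \in [:: x1; x2; x3] -> x < n by move/(subseq1_mem sub)/lt_n.
have [h1 [h2 h3]] : x1 < n /\ x2 < n /\ x3 < n by rewrite !h // !inE eqxx ?orbT.
by move=> /andP[? ?]; apply: (av _ _ _ sub); apply/andP; split; lia.
Qed.

Lemma av213_revcomp l : (forall x, x \in l -> x < n) -> av132 l -> av213 (revcomp n l).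
Proof.
move=> lt_n av a b c /subseq_revcomp[s E sub].
have [x1 [x2 [x3 Es]]] : exists x1 x2 x3, s = [:: x1; x2; x3].
  have := congr1 size E; rewrite size_rev size_map.
  by case: s {E sub} => [|x1 [|x2 [|x3 []]]] // _; exists x1, x2, x3.
subst s; case: E => -> -> ->.
have h x : x \in [:: x1; x2; x3] -> x < n by move/(subseq1_mem sub)/lt_n.
have [h1 [h2 h3]] : x1 < n /\ x2 < n /\ x3 < n by rewrite !h // !inE eqxx ?orbT.
by move=> /andP[? ?]; apply: (av _ _ _ sub); apply/andP; split; lia.
Qed.
End RevComp.

(** The half-turn fixes 1324 and exchanges 132 with 213. *)
Lemma at_least_domino_rev k b t : at_least k (domino b t) -> at_least k (domino t b).
Proof.
apply: (at_least_map (f := revcomp (b + t))) => [l [pe av avl avr]|l l' [pe _ _ _] [pe' _ _ _]].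
  have lt x : x \in l -> x < b + t by rewrite (perm_mem pe) mem_iota.
  have sz : size l = b + t by rewrite (perm_size pe) size_iota.
  split; rewrite 1?(addnC t b).
  - exact: perm_revcomp.
  - exact: av1324_revcomp.
  - rewrite /revcomp take_rev -map_drop size_map sz addnK -/(revcomp _ _).
    by apply: av132_revcomp => // x /mem_drop/lt.
  - rewrite /revcomp drop_rev -map_take size_map sz addnK -/(revcomp _ _).
    by apply: av213_revcomp => // x /mem_take/lt.
exact: revcomp_inj.
Qed.

Lemma sorted_subseq_iota n s : sorted ltn s -> (forall x, x \in s -> x < n) ->
  subseq s (iota 0 n).
Proof.
move=> srt lt_n; suff <- : filter (mem s) (iota 0 n) = s by apply: filter_subseq.
apply: (irr_sorted_eq ltn_trans ltnn) => //.
  by apply: sorted_filter (iota_ltn_sorted _ _); exact: ltn_trans.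
by move=> x; rewrite mem_filter mem_iota andb_idr //= => /lt_n.
Qed.

Lemma nth_subseq (l s : seq nat) : sorted ltn s -> (forall x, x \in s -> x < size l) ->
  subseq [seq nth 0 l i | i <- s] l.
Proof.
move=> srt lt_n; rewrite -{2}(mkseq_nth 0 l); apply: map_subseq.
exact: sorted_subseq_iota.
Qed.

Lemma subseq_index (l s : seq nat) : sorted ltn [seq index x l | x <- s] ->
  {subset s <= l} -> subseq s l.
Proof.
move=> srt sub.
have -> : s = [seq nth 0 l i | i <- [seq index x l | x <- s]].
  rewrite -map_comp -[LHS]map_id; apply/eq_in_map => x /sub xl /=.
  by rewrite nth_index.
by apply: nth_subseq => // _ /mapP[x /sub xl ->]; rewrite index_mem.
Qed.

Section Inverse.
Variables (n : nat) (l : seq nat).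
Hypothesis pe : perm_eq l (iota 0 n).

Lemma size_perm_iota : size l = n.
Proof. by rewrite (perm_size pe) size_iota. Qed.

Lemma mem_perm_iota x : (x \in l) = (x < n).
Proof. by rewrite (perm_mem pe) mem_iota. Qed.

Lemma perm_inv_seq : perm_eq (inv_seq n l) (iota 0 n).
Proof.
apply: perm_iotaP; last 1 first.
- move=> _ /mapP[x + ->]; rewrite mem_iota add0n /= -mem_perm_iota -index_mem.
  by rewrite size_perm_iota.
- rewrite map_inj_in_uniq ?iota_uniq // => x y.
  rewrite !mem_iota !add0n /= -!mem_perm_iota => xl yl E.
  by rewrite -(nth_index 0 xl) E nth_index.
by rewrite size_map size_iota.
Qed.

Lemma subseq_inv_seq s : subseq s (inv_seq n l) ->
  exists2 s', s = [seq index x l | x <- s'] & sorted ltn s' /\ {subset s' <= l}.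
Proof.
case/subseq_mapP=> s' -> sub; exists s' => //; split.
  by apply: subseq_sorted sub (iota_ltn_sorted _ _); exact: ltn_trans.
by move=> x /(mem_subseq sub); rewrite mem_iota mem_perm_iota.
Qed.

Lemma av1324_inv_seq : av1324 l -> av1324 (inv_seq n l).
Proof.
move=> av a b c d /subseq_inv_seq[s E [srt sub]].
have [x1 [x2 [x3 [x4 Es]]]] : exists x1 x2 x3 x4, s = [:: x1; x2; x3; x4].
  have := congr1 size E; rewrite size_map.
  by case: s {E srt sub} => [|x1 [|x2 [|x3 [|x4 []]]]] // _; exists x1, x2, x3, x4.
subst s; case: E => -> -> -> -> /and3P[lt13 lt32 lt24].
move: srt => /= /and4P[lt12 lt23 lt34 _].
apply: (av x1 x3 x2 x4); last exact/and3P.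
apply: subseq_index; first by rewrite /= lt13 lt32 lt24.
by move=> x xs; apply: sub; move: xs; rewrite !inE => /or4P[] ->; rewrite ?orbT.
Qed.

(** Reflection in the antidiagonal turns the last [t] positions into the [t] smallest values and 213
    into 132, and fixes 1324. *)
Lemma lower_cell_anti t : right_cell n t l -> lower_cell n t (revcomp n (inv_seq n l)).
Proof.
case=> _ av avr le_tn; have pe' := perm_inv_seq.
have lt_n x : x \in inv_seq n l -> x < n by rewrite (perm_mem pe') mem_iota.
split=> //; first exact: perm_revcomp.
  by apply: av1324_revcomp => //; apply: av1324_inv_seq.
move=> a b c; rewrite subseq_filter => /andP[/= /and4P[lt_a lt_b lt_c _]].
case/subseq_revcomp=> s' E sub'; have [s Es [srt sub]] := subseq_inv_seq sub'.
have [x1 [x2 [x3 Es3]]] : exists x1 x2 x3, s = [:: x1; x2; x3].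
  have := congr1 size E; rewrite Es size_rev !size_map.
  by case: s {E Es srt sub} => [|x1 [|x2 [|x3 []]]] // _; exists x1, x2, x3.
subst s s'; case: E => Ea Eb Ec /andP[ac cb].
move: srt => /= /and3P[lt12 lt23 _].
have idx x : x \in [:: x1; x2; x3] -> index x l < n.
  by move=> /sub; rewrite -size_perm_iota index_mem.
have [i1 i2 i3] : [/\ index x1 l < n, index x2 l < n & index x3 l < n].
  by split; apply: idx; rewrite !inE eqxx ?orbT.
have lt21 : index x2 l < index x1 l by lia.
have lt213 : index x1 l < index x3 l by lia.
have : subseq [:: x2; x1; x3] l.
  apply: subseq_index; first by rewrite /= lt21 lt213.
  by move=> x xs; apply: sub; move: xs; rewrite !inE => /or3P[] ->; rewrite ?orbT.
rewrite -[X in subseq _ X](cat_take_drop (n - t)).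
case/subseq_catP=> -[|y s1] [s2 [/= E2 sub1 sub2]].
  by apply: (avr x2 x1 x3); [rewrite E2 | rewrite lt12 lt23].
have := index_ltn (subseq1_mem sub1 (mem_head _ _)).
by case: E2 => <- _; lia.
Qed.
End Inverse.

Lemma at_least_anti k n t : at_least k (right_cell n t) -> at_least k (lower_cell n t).
Proof.
apply: (at_least_map (f := fun l => revcomp n (inv_seq n l)))
  => [l cl|l l' [pe _ _ _] [pe' _ _ _]].
  by apply: lower_cell_anti => //; case: cl.
move/(revcomp_inj (perm_inv_seq pe) (perm_inv_seq pe')) => E.
have idx x : index x l = index x l'.
  case: (ltnP x n) => [lt_x|le_x]; last first.
    rewrite !memNindex ?(mem_perm_iota pe) ?(mem_perm_iota pe') -?leqNgt //.
    by rewrite (size_perm_iota pe) (size_perm_iota pe').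
  have := congr1 (nth 0 ^~ x) E; rewrite !(nth_map 0) ?size_iota // nth_iota //.
apply: (@eq_from_nth _ 0) => [|i]; first by rewrite (size_perm_iota pe) (size_perm_iota pe').
move=> lt_i; have il : nth 0 l i \in l by apply: mem_nth.
have il' : nth 0 l i \in l' by rewrite (mem_perm_iota pe') -(mem_perm_iota pe).
rewrite -[LHS](nth_index 0 il') -idx index_uniq // (perm_uniq pe) iota_uniq //.
Qed.

Lemma S1324_at_least k n b : 0 < n -> at_least k (lower_cell n b) -> k <= S1324 n.
Proof.
case: n => // n _ [ls [uls le_k cl]]; apply: leq_trans le_k _.
pose f (l : seq nat) : {ffun 'I_n.+1 -> 'I_n.+1} := [ffun i : 'I_n.+1 => inord (nth 0 l i)].
have fE l i : l \in ls -> f l i = nth 0 l i :> nat.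
  case/cl=> pe _ _ _; rewrite ffunE inordK //.
  by rewrite -(mem_perm_iota pe) mem_nth // (size_perm_iota pe).
have f_inj l : l \in ls -> injectiveb (f l).
  move=> ll; have [pe _ _ _] := cl _ ll; apply/injectiveP => i j /(congr1 val).
  rewrite /= !fE // => /eqP; rewrite nth_uniq ?(size_perm_iota pe) //.
    by move/eqP/val_inj.
  by rewrite (perm_uniq pe) iota_uniq.
(* The default [1%g] is never reached: [gE] shows that the choice succeeds on every list of [ls]. *)
pose g l : 'S_n.+1 := odflt 1%g [pick s : 'S_n.+1 | [forall i, s i == f l i]].
have gE l i : l \in ls -> g l i = nth 0 l i :> nat.
  move=> ll; rewrite -fE // /g; case: pickP => [s /forallP/(_ i)/eqP -> //|none].
  have /negP[] := none (perm (injectiveP _ (f_inj _ ll))).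
  by apply/forallP => j; rewrite permE.
rewrite /S1324 -(size_map g) cardE.
apply: uniq_leq_size.
  rewrite map_inj_in_uniq // => l l' ll ll' E.
  have [pe _ _ _] := cl _ ll; have [pe' _ _ _] := cl _ ll'.
  apply: (@eq_from_nth _ 0); first by rewrite (size_perm_iota pe) (size_perm_iota pe').
  move=> i; rewrite (size_perm_iota pe) => lt_i.
  by rewrite -(gE l (Ordinal lt_i)) // -(gE l' (Ordinal lt_i)) // E.
move=> _ /mapP[l ll ->]; rewrite mem_enum inE /avoids; apply/negP => /existsP[h /forallP H].
have [pe av _ _] := cl _ ll.
have P (i j : 'I_4) : ((i < j) ==> (h i < h j)) &&
    ((nth 0 l (h i) < nth 0 l (h j)) == (nth 0 [:: 1; 3; 2; 4] i < nth 0 [:: 1; 3; 2; 4] j)).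
  by have /forallP/(_ j) := H i; rewrite !gE.
(* Three pairs order the positions; the other three order the values, along the indices 0, 2, 1, 3
   of the pattern. *)
have := P (inord 0) (inord 1); have := P (inord 1) (inord 2); have := P (inord 2) (inord 3).
have := P (inord 0) (inord 2); have := P (inord 2) (inord 1); have := P (inord 1) (inord 3).
rewrite !inordK //= => /andP[_ /eqP v13] /eqP v21 /andP[_ /eqP v02].
move=> /andP[p23 _] /andP[p12 _] /andP[p01 _].
have : subseq [seq nth 0 l i | i <-
    [:: h (inord 0) : nat; h (inord 1) : nat; h (inord 2) : nat; h (inord 3) : nat]] l.
  apply: nth_subseq; first by rewrite /= p01 p12 p23.
  by move=> x; rewrite (size_perm_iota pe) !inE => /or4P[] /eqP ->; apply: ltn_ord.
by move/av; apply; rewrite v02 v21 v13.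
Qed.

(** * Chains of dominoes *)

Section Chain.
Import ring.

Lemma lower_cell_decr b : at_least 1 (lower_cell b b).
Proof.
exists [:: rev (iota 0 b)]; split=> // l; rewrite inE => /eqP ->.
have incr s : subseq s (rev (iota 0 b)) -> sorted ltn (rev s).
  rewrite -{1}[s]revK subseq_rev => sub.
  by apply: subseq_sorted sub (iota_ltn_sorted _ _); exact: ltn_trans.
split=> //.
- by rewrite perm_rev.
- by move=> x y z t /incr /= /and4P[? ? ? _] /and3P[]; lia.
- move=> x y z; rewrite subseq_filter => /andP[_ /incr /= /and3P[? ? _]] /andP[]; lia.
Qed.

Definition nb_links (b : nat) : nat := 'C(b + b./2, b./2) ^ 2.

(** A period glues a domino and then its half-turn, each followed by the reflection, which brings
    the free cell back to size [b]. The chain starts from a decreasing cell. *)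
Lemma at_least_chain k b t i : at_least k (domino b t) ->
  at_least ((k ^ 2 * nb_links b * nb_links t) ^ i)
    (lower_cell (b + i * (2 * (b + t) + (b./2 + t./2))) b).
Proof.
move=> dom; have dom' := at_least_domino_rev dom; elim: i => [|i IH].
  by rewrite mul0n addn0; apply: lower_cell_decr.
have := at_least_anti (at_least_glue b./2 IH dom).
move/at_least_glue/(_ dom')=> /(_ t./2)/at_least_anti; rewrite -!/(nb_links _).
congr (at_least _ (lower_cell _ _)); last by ring.
by rewrite [_ ^ i.+1]expnS; move: (_ ^ i) => G; rewrite -mulnn; ring.
Qed.

(** Induction on the ratio of consecutive binomials, 3(3r+1)(3r+2) / (2(r+1)(2r+1)), which tends to
    27/4; the factor 3r + 1 makes up for its deficit. *)
Lemma bin_triple r : 27 ^ r <= 'C(3 * r, r) * (3 * r).+1 * 4 ^ r.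
Proof.
elim: r => [//|r IH].
have rec : 'C(3 * r.+1, r.+1) * (r.+1 * 2 * (2 * r).+1) =
    'C(3 * r, r) * (3 * (3 * r).+2 * (3 * r).+1).
  have f1 : 'C(3 * r, r) * (r`! * (2 * r)`!) = (3 * r)`!.
    by rewrite -(bin_fact (_ : r <= 3 * r)); [congr (_ * (_ * _`!)); lia | lia].
  have f2 : 'C(3 * r.+1, r.+1) * (r.+1`! * (2 * r).+2`!) = (3 * r).+3`!.
    have -> : (3 * r).+3 = 3 * r.+1 by ring.
    by rewrite -(bin_fact (_ : r.+1 <= 3 * r.+1)); [congr (_ * (_ * _`!)); lia | lia].
  rewrite !factS -f1 in f2.
  have p_gt0 : 0 < r.+1 * (r`! * (2 * r)`!) by rewrite !muln_gt0 !fact_gt0.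
  apply/eqP; rewrite -(eqn_pmul2r p_gt0); apply/eqP.
  transitivity ('C(3 * r.+1, r.+1) * (r.+1 * r`! * ((2 * r).+2 * ((2 * r).+1 * (2 * r)`!)))).
    by ring.
  by rewrite f2; ring.
have p_gt0 : 0 < r.+1 * 2 * (2 * r).+1 by [].
rewrite -(leq_pmul2r p_gt0).
apply: (@leq_trans (('C(3 * r, r) * (3 * r).+1 * 4 ^ r) * (27 * (r.+1 * 2 * (2 * r).+1)))).
  by rewrite expnS; move: IH; rewrite -mulnA [27 * _]mulnC -mulnA => IH; rewrite leq_mul.
have -> : 'C(3 * r.+1, r.+1) * (3 * r.+1).+1 * 4 ^ r.+1 * (r.+1 * 2 * (2 * r).+1) =
   ('C(3 * r.+1, r.+1) * (r.+1 * 2 * (2 * r).+1)) * ((3 * r.+1).+1 * 4 * 4 ^ r).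
  by rewrite expnS; ring.
rewrite rec.
have -> : 'C(3 * r, r) * (3 * (3 * r).+2 * (3 * r).+1) * ((3 * r.+1).+1 * 4 * 4 ^ r) =
  ('C(3 * r, r) * (3 * r).+1 * 4 ^ r) * (3 * (3 * r).+2 * ((3 * r.+1).+1 * 4)) by ring.
by rewrite leq_mul2l; apply/orP; right; nia.
Qed.

Lemma nb_links_ge n b : b <= n -> 729 ^ b./2 <= nb_links b * (3 * n).+1 ^ 2 * 16 ^ b./2.
Proof.
move=> le_bn; rewrite -[729]/(27 ^ 2) -[16]/(4 ^ 2) -!expnM ![2 * _]mulnC !expnM -!expnMn.
rewrite leq_sqr; apply: leq_trans (bin_triple _) _.
rewrite !leq_mul //; last by have := odd_double_half b; lia.
by apply: leq_bin2l; have := odd_double_half b; lia.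
Qed.

(** The sixth power collects the square of the pigeonhole factor and two squares from the links; 2
    [rho] + 2 accounts for rounding both halves down. *)
Lemma chain_lower_bound (C : nat) : exists N D rho b F,
  [/\ 0 < N <= 2 * rho + 2, C * 1337 ^ N < 200 ^ N * D,
      D ^ 2 * 729 ^ rho <= F * (3 * N).+1 ^ 6 * 16 ^ rho
    & forall i, F ^ i.+1 <= S1324 (b + i.+1 * (2 * N + rho))].
Proof.
(* With [C.+1] the case [N = 0] is impossible, even for [C = 0], since there is one empty word. *)
have [N lt_N] := words_growth C.+1.
have [b [t [k [EN le_D dom]]]] := many_dominoes N.
have N_gt0 : 0 < N.
  by rewrite lt0n; apply/eqP => N0; move: lt_N; rewrite N0 !expn0 mul1n muln1.
exists N, (size (words N)), (b./2 + t./2), b, (k ^ 2 * nb_links b * nb_links t); split.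
- by rewrite N_gt0 /=; have := odd_double_half b; have := odd_double_half t; lia.
- by apply: leq_trans lt_N; rewrite ltnS leq_mul.
- have lb := @nb_links_ge N b; have lt := @nb_links_ge N t.
  rewrite !expnD; set M := (3 * N).+1.
  apply: (@leq_trans ((M * k) ^ 2 *
    ((nb_links b * M ^ 2 * 16 ^ b./2) * (nb_links t * M ^ 2 * 16 ^ t./2)))).
    apply: leq_mul; last by apply: leq_mul; [apply: lb | apply: lt]; lia.
    by rewrite leq_sqr; apply: leq_trans le_D _; rewrite leq_mul2r /M; lia.
  apply: eq_leq; rewrite expnMn; move: (16 ^ _) (16 ^ _) => x y; ring.
move=> i; rewrite -EN; apply: S1324_at_least (at_least_chain i.+1 dom).
lia.
Qed.

End Chain.

(* Passage to the limit in the real numbers *)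
From Stdlib Require Import Reals Lra Lia.
Open Scope R_scope.

Lemma INR_leq m n : leq m n -> INR m <= INR n.
Proof. by move/leP/le_INR. Qed.

Lemma INR_ltn m n : leq m.+1 n -> INR m < INR n.
Proof. by move/leP/lt_INR. Qed.

Lemma INR_muln m n : INR (muln m n) = INR m * INR n.
Proof. exact: mult_INR. Qed.

Lemma INR_expn m n : INR (expn m n) = INR m ^ n.
Proof. by elim: n => [//|n IH]; rewrite expnS INR_muln IH. Qed.

(* Bernoulli's inequality, then the 12th power. *)
Lemma poly_exp_bound (h : R) (n : nat) : 0 < h ->
  (3 * INR n + 1) ^ 12 <= (3 / h + 1) ^ 12 * ((1 + h) ^ 12) ^ n.
Proof.
move=> h_gt0; have n_ge0 := pos_INR n.
rewrite -pow_mult Nat.mul_comm pow_mult -Rpow_mult_distr.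
apply: pow_incr; split; first lra.
have bern : 1 + INR n * h <= (1 + h) ^ n by apply: poly; lra.
apply: (Rle_trans _ ((3 / h + 1) * (1 + INR n * h))).
  have e : 3 / h * (INR n * h) = 3 * INR n by field; lra.
  have p1 : 0 < 3 / h by apply: Rdiv_lt_0_compat; lra.
  have p2 : 0 <= INR n * h by apply: Rmult_le_pos; lra.
  nra.
apply: Rmult_le_compat_l => //.
by have : 0 < 3 / h by [apply: Rdiv_lt_0_compat; lra]; lra.
Qed.

(** Powers of F / q would outgrow any constant if F exceeded q. *)
Lemma pow_le_base (F q c : R) : 0 < q ->
  (exists i0, forall i, (i0 <= i)%coq_nat -> F ^ i <= c * q ^ i) -> F <= q.
Proof.
move=> q_gt0 [i0 le_F]; case: (Rle_lt_dec F q) => // lt_qF; exfalso.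
have x_gt1 : 1 < F / q.
  by apply: (Rmult_lt_reg_r q) => //; rewrite Rmult_1_l /Rdiv Rmult_assoc Rinv_l; lra.
have abs_gt1 : Rabs (F / q) > 1 by rewrite Rabs_pos_eq; lra.
have [i1 big] := Pow_x_infinity _ abs_gt1 (c + 1).
pose i := Nat.max i0 i1.
have := big i (Nat.le_max_r _ _); have := le_F i (Nat.le_max_l _ _).
have q_i : 0 < q ^ i by apply: pow_lt.
rewrite Rabs_pos_eq; last by apply: pow_le; lra.
rewrite /Rdiv Rpow_mult_distr pow_inv => le1 /Rge_le le2.
have : (c + 1) * q ^ i <= F ^ i.
  apply: (Rle_trans _ (F ^ i * / q ^ i * q ^ i)); first by apply: Rmult_le_compat_r; lra.
  by rewrite Rmult_assoc Rinv_l; lra.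
lra.
Qed.

Lemma lt_pow_of_root (S : nat) (n : nat) (x : R) : (0 < n)%coq_nat -> 0 < x ->
  Rpower (INR S) (/ INR n) < x -> INR S <= x ^ n.
Proof.
move=> n_gt0 x_gt0 lt_x; have nR : 0 < INR n by apply: lt_0_INR.
(* [Rpower] has a meaningless default value at base 0, so this case is treated apart. *)
case: (Rle_lt_dec (INR S) 0) => [S0|S_gt0].
  by apply: Rle_trans S0 _; apply: pow_le; lra.
rewrite -Rpower_pow // -[INR S]Rpower_1 // -(Rinv_l (INR n)); last lra.
rewrite -Rpower_mult; apply: Rle_Rpower_l; first lra.
by split; [apply: exp_pos | lra].
Qed.

(* gr(Av(1324)) = lim_n S_n(1324)^(1/n); the limit exists (known fact), and we
   state that its value exceeds 9.81. *)
Theorem theorem1 :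
  forall L : R,
    Un_cv (fun n : nat => Rpower (INR (S1324 n)) (/ INR n)) L ->
    L > 981 / 100.
Proof.
move=> L cv; apply: Rnot_le_gt => le_L.
(* Any number slightly above 9.81 will do; [h] then only has to be small enough. *)
pose mu := 9811 / 1000.
have [n0 lt_mu] : exists n0, forall n, (n0 <= n)%coq_nat -> (0 < n)%coq_nat ->
    INR (S1324 n) <= mu ^ n.
  have [n0 near] := cv (1 / 1000) ltac:(lra); exists n0 => n le_n n_gt0.
  apply: lt_pow_of_root => //; first by rewrite /mu; lra.
  by have := near n le_n; rewrite /R_dist => /Rabs_def2[]; rewrite /mu; lra.
(* [x] is mu / 6.75^2, where 6.75^2 = 729/16 is the gain per entry of a decreasing cell. *)
pose h := 1 / 20000; pose x := 16 * mu / 729.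
have h_gt0 : 0 < h by rewrite /h; lra.
have mu_gt0 : 0 < mu by rewrite /mu; lra.
have x_gt0 : 0 < x by rewrite /x /mu; lra.
(* Chosen to contradict the final bound [C_le], through C <= C^4 for a natural number. *)
have [C lt_C] : exists C : nat, (3 / h + 1) ^ 12 < INR C * x ^ 2.
  have x2_gt0 : 0 < x ^ 2 by apply: pow_lt.
  have [C le_C] := INR_unbounded ((3 / h + 1) ^ 12 / x ^ 2); exists C.
  apply: (Rmult_lt_reg_r (/ x ^ 2)); first exact: Rinv_0_lt_compat.
  by rewrite Rmult_assoc Rinv_r ?Rmult_1_r //; lra.
have [N [D [rho [b [F [/andP[N_gt0 le_N] lt_D le_F chain]]]]]] := chain_lower_bound C.
(* Letting the number of periods grow leaves the gain of one period; the fixed offset [b] only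
   contributes a constant factor. *)
have F_le : INR F <= mu ^ (2 * N + rho)%nat.
  apply: (@pow_le_base _ _ (mu ^ b)); first exact: pow_lt.
  exists n0.+1 => -[|i] le_i; first by lia.
  rewrite -pow_mult -pow_add -INR_expn; apply: Rle_trans (INR_leq (chain i)) _.
  have -> : (b + (2 * N + rho) * i.+1)%coq_nat = addn b (muln i.+1 (addn (muln 2 N) rho)).
    by rewrite mulnC.
  by apply: lt_mu; move/leP: N_gt0; rewrite -plusE -multE; nia.
have {}lt_D : INR C * (1337 / 200) ^ N < INR D.
  move/INR_ltn: lt_D; rewrite !INR_muln !INR_expn /Rdiv Rpow_mult_distr pow_inv => lt_D.
  have p : 0 < 200 ^ N by apply: pow_lt; lra.
  have e1 : INR 1337 = 1337 by rewrite INR_IZR_INZ.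
  have e2 : INR 200 = 200 by rewrite INR_IZR_INZ.
  rewrite e1 e2 in lt_D; apply: (Rmult_lt_reg_r (200 ^ N)) => //.
  by rewrite !Rmult_assoc Rinv_l; lra.
have {}le_F : INR D ^ 2 * 729 ^ rho <= INR F * (3 * INR N + 1) ^ 6 * 16 ^ rho.
  move/INR_leq: le_F; rewrite !INR_muln !INR_expn.
  have e0 : INR (muln 3 N).+1 = 3 * INR N + 1 by rewrite S_INR INR_muln INR_IZR_INZ.
  have e1 : INR 729 = 729 by rewrite INR_IZR_INZ.
  have e2 : INR 16 = 16 by rewrite INR_IZR_INZ.
  rewrite e0 e1 e2 => le_F.
  by apply: Rle_trans (Rle_trans _ _ _ _ le_F) _; apply: Req_le; ring.
have n_ge0 := pos_INR N; have D_ge0 := pos_INR D; have C_ge0 := pos_INR C.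
set M := 3 * INR N + 1 in le_F.
have M_gt0 : 0 < M by rewrite /M; lra.
have D2_le : INR D ^ 2 <= mu ^ (2 * N) * M ^ 6 * x ^ rho.
  have p : 0 < 729 ^ rho by apply: pow_lt; lra.
  apply: (Rmult_le_reg_r (729 ^ rho)) => //; apply: Rle_trans le_F _.
  have -> : mu ^ (2 * N) * M ^ 6 * x ^ rho * 729 ^ rho =
            mu ^ (2 * N + rho) * M ^ 6 * 16 ^ rho.
    have -> : mu ^ (2 * N + rho) = mu ^ (2 * N) * mu ^ rho by apply: pow_add.
    have e : x ^ rho * 729 ^ rho = mu ^ rho * 16 ^ rho.
      by rewrite -!Rpow_mult_distr; congr (_ ^ _); rewrite /x; field.
    by rewrite Rmult_assoc e; move: (mu ^ (2 * N)) (mu ^ rho) (16 ^ rho) => *; ring.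
  apply: Rmult_le_compat_r; first by apply: pow_le; lra.
  by apply: Rmult_le_compat_r => //; apply: pow_le; lra.
have x_lt1 : x < 1 by rewrite /x /mu; lra.
(* As x < 1, the rounding loss of at most 2 in the exponent costs only the constant x^2. *)
have x_rho : x ^ rho * x ^ rho * x ^ 2 <= x ^ N.
  rewrite -!pow_add; have -> : (rho + rho + 2 = N + (rho + rho + 2 - N))%coq_nat.
    by move/leP: le_N; rewrite -plusE -multE; lia.
  rewrite pow_add -[X in _ <= X]Rmult_1_r; apply: Rmult_le_compat_l; first by apply: pow_le; lra.
  by rewrite -(pow1 (rho + rho + 2 - N)); apply: pow_incr; lra.
(* This is the inequality mu^5 (1 + h)^12 <= 6.685^4 * 6.75^2, true with less than 0.1 percent to
   spare. *)
have base : mu ^ 4 * x * (1 + h) ^ 12 <= (1337 / 200) ^ 4.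
  by rewrite /x /mu /h; lra.
have low : INR C ^ 4 * ((1337 / 200) ^ 4) ^ N <= INR D ^ 4.
  have -> : ((1337 / 200) ^ 4) ^ N = ((1337 / 200) ^ N) ^ 4 by rewrite -!pow_mult Nat.mul_comm.
  rewrite -Rpow_mult_distr; apply: pow_incr; split; last lra.
  by apply: Rmult_le_pos => //; apply: pow_le; lra.
have high : INR D ^ 4 * x ^ 2 <= (mu ^ 4 * x) ^ N * M ^ 12.
  have -> : INR D ^ 4 * x ^ 2 = INR D ^ 2 * INR D ^ 2 * x ^ 2 by ring.
  apply: (Rle_trans _
    ((mu ^ (2 * N) * M ^ 6 * x ^ rho) * (mu ^ (2 * N) * M ^ 6 * x ^ rho) * x ^ 2)).
    apply: Rmult_le_compat_r; first by apply: pow_le; lra.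
    by apply: Rmult_le_compat => //; apply: pow_le.
  have -> : (mu ^ 4 * x) ^ N * M ^ 12 = mu ^ (2 * N) * mu ^ (2 * N) * M ^ 12 * x ^ N.
    have -> : (mu ^ 4 * x) ^ N = mu ^ (2 * N) * mu ^ (2 * N) * x ^ N.
      rewrite Rpow_mult_distr -pow_mult -pow_add; congr (mu ^ _ * _).
      by rewrite -?multE -?plusE; lia.
    by move: (mu ^ (2 * N)) (x ^ N) => *; ring.
  have -> : mu ^ (2 * N) * M ^ 6 * x ^ rho * (mu ^ (2 * N) * M ^ 6 * x ^ rho) * x ^ 2 =
      mu ^ (2 * N) * mu ^ (2 * N) * M ^ 12 * (x ^ rho * x ^ rho * x ^ 2).
    by move: (mu ^ (2 * N)) (x ^ rho) => *; ring.
  apply: Rmult_le_compat_l => //.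
  by apply: Rmult_le_pos; [apply: Rmult_le_pos | ]; apply: pow_le; lra.
have := poly_exp_bound N h_gt0; rewrite -/M => poly.
have s_gt0 : 0 < ((1337 / 200) ^ 4) ^ N by do 2 apply: pow_lt; lra.
have C_le : INR C ^ 4 * x ^ 2 <= (3 / h + 1) ^ 12.
  apply: (Rmult_le_reg_r (((1337 / 200) ^ 4) ^ N)) => //.
  apply: (Rle_trans _ (INR D ^ 4 * x ^ 2)).
    have -> : INR C ^ 4 * x ^ 2 * ((1337 / 200) ^ 4) ^ N =
              INR C ^ 4 * ((1337 / 200) ^ 4) ^ N * x ^ 2 by ring.
    by apply: Rmult_le_compat_r low; apply: pow_le; lra.
  apply: Rle_trans high _.
  have mx_ge0 : 0 <= (mu ^ 4 * x) ^ N.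
    by apply: pow_le; apply: Rmult_le_pos; [apply: pow_le | ]; lra.
  apply: Rle_trans (Rmult_le_compat_l _ _ _ mx_ge0 poly) _.
  have -> : (mu ^ 4 * x) ^ N * ((3 / h + 1) ^ 12 * ((1 + h) ^ 12) ^ N) =
    (3 / h + 1) ^ 12 * (mu ^ 4 * x * (1 + h) ^ 12) ^ N.
    by rewrite [(mu ^ 4 * x * _) ^ N]Rpow_mult_distr; ring.
  apply: Rmult_le_compat_l.
    by apply: pow_le; have : 0 < 3 / h by [apply: Rdiv_lt_0_compat; lra]; lra.
  apply: pow_incr; split=> //.
  apply: Rmult_le_pos; last by apply: pow_le; lra.
  by apply: Rmult_le_pos; [apply: pow_le | ]; lra.
have C_le4 : INR C <= INR C ^ 4.
  case: (Nat.eq_0_gt_0_cases C) => [->|/le_INR /= C_ge1]; first by rewrite /=; lra.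
  by have := Rle_pow (INR C) 1 4 C_ge1 ltac:(lia); rewrite pow_1.
have x2_gt0 : 0 < x ^ 2 by apply: pow_lt.
by have := Rmult_le_compat_r _ _ _ (Rlt_le _ _ x2_gt0) C_le4; lra.
Qed.
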